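(* Let $n\ge 3$ and let $\Gamma\subset\mathbb{R}^n$ be an open convex symmetric cone with vertex at the origin such that $\{\lambda:\lambda_i>0,\ 1\le i\le n\}\subset\Gamma\subset\{\lambda:\sum_{i=1}^n\lambda_i>0\}$. Let $0\le a<b\le\infty$. Then every radially symmetric positive viscosity solution $u$ of $\lambda(A^u)\in\partial\Gamma$ in $\{a<|x|<b\}$ is one of the following smooth solutions: (a) $u(x)=C_1|x|^{-C_2}$ with $C_1>0$, $0\le C_2\le n-2$, when $\mu_\Gamma^+=1$; (b) $u(x)=\big(C_3|x|^{-\mu_\Gamma^++1}+C_4\big)^{\frac{n-2}{\mu_\Gamma^+-1}}$ with $C_3\ge 0$, $C_4\ge 0$, $C_3+C_4>0$, when $\mu_\Gamma^+\ne 1$; (c) $u(x)=\big(C_5|x|^{-\mu_\Gamma^-+1}-C_6\big)^{\frac{n-2}{\mu_\Gamma^--1}}$ with $C_5>0$, $C_6\ge 0$, $\lim_{r\to b}\big(C_5r^{-\mu_\Gamma^-+1}-C_6\big)\ge 0$, when $\mu_\Gamma^-<\infty$; (d) $u(x)=\big(-C_7|x|^{-\mu_\Gamma^-+1}+C_8\big)^{\frac{n-2}{\mu_\Gamma^--1}}$ with $C_7\ge 0$, $C_8>0$, $\lim_{r\to a}\big(-C_7r^{-\mu_\Gamma^-+1}+C_8\big)\ge 0$, when $\mu_\Gamma^-<\infty$.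
   Context: $\{a<|x|<b\}=\{x\in\mathbb{R}^n: a<|x|<b\}$. ''Symmetric'' (for $\Gamma$) means invariant under permutations of coordinates. For a positive $C^2$ function $u$, $A^u$ is the symmetric matrix with entries \[ (A^u)_{ij}=-\frac{2}{n-2}u^{-\frac{n+2}{n-2}}\nabla_{ij}u+\frac{2n}{(n-2)^2}u^{-\frac{2n}{n-2}}\nabla_iu\nabla_ju-\frac{2}{(n-2)^2}u^{-\frac{2n}{n-2}}|\nabla u|^2\delta_{ij}, \] and $\lambda(A^u)$ denotes its eigenvalues. Viscosity sense. Let $\Omega\subset\mathbb{R}^n$ be open. A positive lower semicontinuous (resp. upper semicontinuous) real-valued function $u$ on $\Omega$ satisfies $\lambda(A^u)\in\bar\Gamma$ (resp. $\lambda(A^u)\in\mathbb{R}^n\setminus\Gamma$) in $\Omega$ in the viscosity sense if for any $x_0\in\Omega$ and $\varphi\in C^2(\Omega)$ with $(u-\varphi)(x_0)=0$ and $u-\varphi\ge 0$ (resp. $u-\varphi\le 0$) near $x_0$, one has $\lambda(A^\varphi(x_0))\in\bar\Gamma$ (resp. $\lambda(A^\varphi(x_0))\in\mathbb{R}^n\setminus\Gamma$). A positive continuous function $u$ is a viscosity solution of $\lambda(A^u)\in\partial\Gamma$ in $\Omega$ if both $\lambda(A^u)\in\bar\Gamma$ and $\lambda(A^u)\in\mathbb{R}^n\setminus\Gamma$ hold in $\Omega$ in the viscosity sense. The constant $\mu_\Gamma^+\in[0,n-1]$ is the unique number such that $(-\mu_\Gamma^+,1,\ldots,1)\in\partial\Gamma$.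 The constant $\mu_\Gamma^-$ is $+\infty$ if $(1,0,\ldots,0)\in\partial\Gamma$; otherwise $\mu_\Gamma^-\in[n-1,\infty)$ is the unique number such that $(\mu_\Gamma^-,-1,\ldots,-1)\in\partial\Gamma$. *)

(* Defs.v *)
From HB Require Import structures.
From mathcomp Require Import all_boot all_order all_algebra all_fingroup.
From mathcomp Require Import all_classical all_reals all_analysis.

Set Implicit Arguments.
Unset Strict Implicit.
Unset Printing Implicit Defensive.
Import Order.TTheory GRing.Theory Num.Theory.
Import numFieldNormedType.Exports.

Local Open Scope classical_set_scope.
Local Open Scope ring_scope.

(** ** Euclidean geometry of R^n *)

(* The library norm on ['rV[R]_n] is the sup norm (it induces the same
   topology), hence a separate Euclidean norm. *)
Definition enorm (R : realType) (n : nat) (x : 'rV[R]_n) : R :=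
  Num.sqrt (\sum_(i < n) x 0 i ^+ 2).

Definition annulus (R : realType) (n : nat) (a : R) (b : \bar R) :
    set 'rV[R]_n :=
  [set x | a < enorm x /\ ((enorm x)%:E < b)%E].

Definition radial_on (R : realType) (n : nat) (Om : set 'rV[R]_n)
    (u : 'rV[R]_n -> R) : Prop :=
  forall x y, Om x -> Om y -> enorm x = enorm y -> u x = u y.

Definition frontier (T : topologicalType) (A : set T) : set T :=
  closure A `\` interior A.

(** ** Functions of class C^k on an open set *)

Definition partial (R : realType) (n : nat) (i : 'I_n) (f : 'rV[R]_n -> R) :
    'rV[R]_n -> R :=
  fun x => 'D_(delta_mx 0 i) f x.

Definition continuous_on (R : realType) (n : nat) (Om : set 'rV[R]_n)
    (f : 'rV[R]_n -> R) : Prop :=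
  forall x, Om x -> {for x, continuous f}.

(* For [Om] open only the values of [f] on [Om] matter. *)
Fixpoint Ck (R : realType) (n : nat) (k : nat) (Om : set 'rV[R]_n)
    (f : 'rV[R]_n -> R) : Prop :=
  match k with
  | 0 => continuous_on Om f
  | k'.+1 => continuous_on Om f /\
      forall i : 'I_n,
        (forall x, Om x -> derivable f x (delta_mx 0 i)) /\
        Ck k' Om (partial i f)
  end.

Definition smooth_on (R : realType) (n : nat) (Om : set 'rV[R]_n)
    (f : 'rV[R]_n -> R) : Prop :=
  forall k, Ck k Om f.

Definition lsc_on (R : realType) (n : nat) (Om : set 'rV[R]_n)
    (f : 'rV[R]_n -> R) : Prop :=
  forall x, Om x -> forall c, c < f x -> \forall y \near x, c < f y.

Definition usc_on (R : realType) (n : nat) (Om : set 'rV[R]_n)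
    (f : 'rV[R]_n -> R) : Prop :=
  forall x, Om x -> forall c, f x < c -> \forall y \near x, f y < c.

(** ** The matrix A^u and its eigenvalues *)

Definition Amx (R : realType) (n : nat) (u : 'rV[R]_n -> R) (x : 'rV[R]_n) :
    'M[R]_n :=
  let N : R := n%:R in
  \matrix_(i, j)
    (- (2 / (N - 2)) * u x `^ (- ((N + 2) / (N - 2)))
       * partial i (partial j u) x
     + 2 * N / (N - 2) ^+ 2 * u x `^ (- (2 * N / (N - 2)))
       * partial i u x * partial j u x
     - 2 / (N - 2) ^+ 2 * u x `^ (- (2 * N / (N - 2)))
       * (\sum_(k < n) partial k u x ^+ 2) * (i == j)%:R).

(* [l] lists the eigenvalues of [M] with algebraic multiplicity. *)
Definition eigenvalues (R : realType) (n : nat) (M : 'M[R]_n)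
    (l : 'rV[R]_n) : Prop :=
  char_poly M = \prod_(i < n) ('X - (l 0 i)%:P).

(* [l] is determined up to the order of its entries, so the meaning does not
   depend on the choice of [l] when [S] is invariant under permutations of
   coordinates, as Gamma, its closure, complement and frontier are. *)
Definition lambda_in (R : realType) (n : nat) (M : 'M[R]_n)
    (S : set 'rV[R]_n) : Prop :=
  exists2 l, eigenvalues M l & S l.

(** ** Viscosity solutions *)

Definition visc_in_closure (R : realType) (n : nat) (G Om : set 'rV[R]_n)
    (u : 'rV[R]_n -> R) : Prop :=
  [/\ forall x, Om x -> 0 < u x,
      lsc_on Om u &
      forall (x0 : 'rV[R]_n) (phi : 'rV[R]_n -> R),
        Om x0 -> Ck 2 Om phi -> u x0 - phi x0 = 0 ->
        (\forall x \near x0, 0 <= u x - phi x) ->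
        lambda_in (Amx phi x0) (closure G)].

Definition visc_in_compl (R : realType) (n : nat) (G Om : set 'rV[R]_n)
    (u : 'rV[R]_n -> R) : Prop :=
  [/\ forall x, Om x -> 0 < u x,
      usc_on Om u &
      forall (x0 : 'rV[R]_n) (phi : 'rV[R]_n -> R),
        Om x0 -> Ck 2 Om phi -> u x0 - phi x0 = 0 ->
        (\forall x \near x0, u x - phi x <= 0) ->
        lambda_in (Amx phi x0) (~` G)].

Definition visc_solution (R : realType) (n : nat) (G Om : set 'rV[R]_n)
    (u : 'rV[R]_n -> R) : Prop :=
  [/\ forall x, Om x -> 0 < u x,
      continuous_on Om u,
      visc_in_closure G Om u &
      visc_in_compl G Om u].

Definition smooth_solution (R : realType) (n : nat) (G Om : set 'rV[R]_n)
    (u : 'rV[R]_n -> R) : Prop :=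
  [/\ forall x, Om x -> 0 < u x,
      smooth_on Om u &
      forall x, Om x -> lambda_in (Amx u x) (frontier G)].

(** ** The cone Gamma and its constants *)

Definition symmetric_set (R : realType) (n : nat) (G : set 'rV[R]_n) : Prop :=
  forall (s : 'S_n) (x : 'rV[R]_n), G x -> G (col_perm s x).

Definition cone_at0 (R : realType) (n : nat) (G : set 'rV[R]_n) : Prop :=
  forall (t : R) (x : 'rV[R]_n), 0 < t -> G x -> G (t *: x).

Definition head_tail (R : realType) (n : nat) (s t : R) : 'rV[R]_n :=
  \row_(i < n) (if i == 0%N :> nat then s else t).

(* [get] picks the unique element of the set. *)
Definition mu_plus (R : realType) (n : nat) (G : set 'rV[R]_n) : R :=
  get [set m : R | 0 <= m <= n%:R - 1 /\ frontier G (head_tail n (- m) 1)].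

Definition mu_minus (R : realType) (n : nat) (G : set 'rV[R]_n) : \bar R :=
  if `[< frontier G (head_tail n 1 0) >] then +oo%E
  else (get [set m : R | n%:R - 1 <= m /\
                         frontier G (head_tail n m (- 1))])%:E.

(** ** The explicit solutions *)

(* The filter of [r --> b] from below, for [b] in []0, +oo]]. *)
Definition to_upper_end (R : realType) (b : \bar R) : set_system R :=
  match b with
  | EFin r => at_left r
  | _ => pinfty_nbhs R
  end.

Definition form_a (R : realType) (n : nat) (G : set 'rV[R]_n)
    (a : R) (b : \bar R) (u : 'rV[R]_n -> R) : Prop :=
  mu_plus G = 1 /\
  exists C1 C2 : R,
    [/\ 0 < C1, 0 <= C2 <= n%:R - 2 &
        forall x, annulus a b x -> u x = C1 * enorm x `^ (- C2)].

Definition form_b (R : realType) (n : nat) (G : set 'rV[R]_n)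
    (a : R) (b : \bar R) (u : 'rV[R]_n -> R) : Prop :=
  let mu := mu_plus G in
  mu != 1 /\
  exists C3 C4 : R,
    [/\ 0 <= C3, 0 <= C4, 0 < C3 + C4 &
        forall x, annulus a b x ->
          u x = (C3 * enorm x `^ (- mu + 1) + C4) `^ ((n%:R - 2) / (mu - 1))].

(* The limits in the next two forms are taken in the extended reals: the
   one at [r --> a] is [-oo] when [a = 0] and [C7 > 0]. *)
Definition form_c (R : realType) (n : nat) (G : set 'rV[R]_n)
    (a : R) (b : \bar R) (u : 'rV[R]_n -> R) : Prop :=
  let mu := fine (mu_minus G) in
  (mu_minus G < +oo)%E /\
  exists C5 C6 : R,
    [/\ 0 < C5, 0 <= C6,
        exists2 l : \bar R,
          (C5 * r `^ (- mu + 1) - C6)%:E @[r --> to_upper_end b] --> l &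
          (0 <= l)%E &
        forall x, annulus a b x ->
          u x = (C5 * enorm x `^ (- mu + 1) - C6) `^ ((n%:R - 2) / (mu - 1))].

Definition form_d (R : realType) (n : nat) (G : set 'rV[R]_n)
    (a : R) (b : \bar R) (u : 'rV[R]_n -> R) : Prop :=
  let mu := fine (mu_minus G) in
  (mu_minus G < +oo)%E /\
  exists C7 C8 : R,
    [/\ 0 <= C7, 0 < C8,
        exists2 l : \bar R,
          (- C7 * r `^ (- mu + 1) + C8)%:E @[r --> at_right a] --> l &
          (0 <= l)%E &
        forall x, annulus a b x ->
          u x = (- C7 * enorm x `^ (- mu + 1) + C8)
                  `^ ((n%:R - 2) / (mu - 1))].

(* Main.v *)
(** Write [t = ln |x|^2] and [u = exp (- (n-2)/2 * h t)].  With [p = h'],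
    [q = h''] and [g = p (1 - p)], the eigenvalues of [A^u] are a positive
    multiple of [(2 q - g, g, ..., g)], so the equation reads [q = - nu g] with
    [nu = (mu_plus - 1) / 2] where [g > 0] and [nu = (mu_minus - 1) / 2] where
    [g < 0].  It says that [exp (- nu h)] is an affine function of
    [exp (- nu t)], which gives the explicit families.

    A viscosity solution is compared on an interval with the exact solution of
    exponent [m] having the same end values: for [m] on the right side of [nu]
    that solution is a strict super- or subsolution, and letting [m] tend to
    [nu] identifies [h] with the exact solution as soon as the chord of [h]
    avoids the slopes 0 and 1.  By the intermediate value theorem applied to the
    slope of the chord in the linearising coordinates, the coincidence extends
    to the whole annulus.  If [mu_minus] is infinite, no parabola with
    [g < 0] touches [h] from above, so every [nu] is admissible there, and a
    large one confines the chords of [h] to slopes between 0 and 1.  If all chords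
    have slope 0 or 1, then [h] is linear. *)

Require Import Defs.
From HB Require Import structures.
From mathcomp Require Import all_boot all_order all_algebra all_fingroup.
From mathcomp Require Import all_classical all_reals all_analysis.
From mathcomp Require Import ring lra.
Import Order.TTheory GRing.Theory Num.Theory.
Import numFieldNormedType.Exports.
Local Open Scope classical_set_scope.
Local Open Scope ring_scope.

Set Implicit Arguments.
Unset Strict Implicit.
Unset Printing Implicit Defensive.

(** * One-variable calculus *)

(** A test parabola of slope exactly 0 or 1 has [g = 0] and tells nothing about [nu], so a
    comparison must stay inside one of the regimes [p > 1], [0 < p < 1], [p < 0]. It does: along an
    exact solution [p] and [1 - p] are the constants [C] and [1 - C] times positive functions, so a
    barrier keeps the signs that its chord gives it. Only touching parabolas are available, and the
    Taylor parabola of a barrier lies above it only after its second derivative is raised by some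
    [e > 0]. The strict gap between [m] and [nu] pays for this [e], which is why comparison is made
    with [m] and not with [nu] itself. The supersolution property gives one inequality. The other
    needs no second argument: the inversion replaces [h] by [t - h], exchanges [p] with [1 - p], and
    turns a subsolution of exponent [nu] into a supersolution of exponent [- nu]. This is why
    exponents of both signs, and 0, are treated together. *)

Section Derivatives.
Context {R : realType}.
Implicit Types (f g h : R -> R) (x y a b : R).

Lemma derD f g x a b : is_derive x 1 f a -> is_derive x 1 g b ->
  is_derive x 1 (fun y => f y + g y) (a + b).
Proof. exact: is_deriveD. Qed.

Lemma derB f g x a b : is_derive x 1 f a -> is_derive x 1 g b ->
  is_derive x 1 (fun y => f y - g y) (a - b).
Proof. exact: is_deriveB. Qed.

Lemma derM f g x a b : is_derive x 1 f a -> is_derive x 1 g b ->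
  is_derive x 1 (fun y => f y * g y) (f x * b + g x * a).
Proof. exact: is_deriveM. Qed.

Lemma derV f x a : f x != 0 -> is_derive x 1 f a ->
  is_derive x 1 (fun y => (f y)^-1) (- (f x) ^- 2 * a).
Proof. exact: is_deriveV. Qed.

Lemma der_cst a x : is_derive x 1 (fun _ : R => a) 0.
Proof. exact: is_derive_cst. Qed.

Lemma der_id x : is_derive x 1 (fun y : R => y) 1.
Proof. exact: is_derive_id. Qed.

Lemma der_comp f g x a b : is_derive (g x) 1 f a -> is_derive x 1 g b ->
  is_derive x 1 (fun y => f (g y)) (a * b).
Proof. exact: is_derive1_comp. Qed.

Lemma der_exp f x a : is_derive x 1 f a ->
  is_derive x 1 (fun y => expR (f y)) (expR (f x) * a).
Proof. by apply: der_comp; exact: is_derive_expR. Qed.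

Lemma der_ln f x a : 0 < f x -> is_derive x 1 f a ->
  is_derive x 1 (fun y => ln (f y)) ((f x)^-1 * a).
Proof. by move=> fx0; apply: der_comp; exact: is_derive1_ln. Qed.

Lemma der_scale a f x b : is_derive x 1 f b ->
  is_derive x 1 (fun y => a * f y) (a * b).
Proof.
by move=> fb; have := derM (der_cst a x) fb; rewrite mulr0 addr0.
Qed.

Lemma der_continuous f x a : is_derive x 1 f a -> {for x, continuous f}.
Proof.
by move=> [fx _]; apply: differentiable_continuous; exact/derivable1_diffP.
Qed.

Lemma der_near f x a (e : R) : is_derive x 1 f a -> 0 < e ->
  \forall y \near x, `|f y - f x - a * (y - x)| <= e * `|y - x|.
Proof.
move=> [fx <-] e0.
have /cvgrPdist_le /(_ e e0) : (h^-1 *: (f (h *: 1 + x) - f x) @[h --> 0^']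
    --> 'D_1 f x)%classic by exact: fx.
rewrite near_withinE => H.
have {}H : \forall y \near 0, y != 0 ->
    `|'D_1 f x - y^-1 *: (f (y *: 1 + x) - f x)| <= e by exact: H.
rewrite (near_shift x 0) in H.
apply: filterS H => y H.
have [->|yx] := eqVneq y x; first by rewrite !subrr mulr0 subrr normr0 mulr0.
have := H; rewrite /= sub0r subr_eq0 => /(_ yx){H}.
have -> : (y - x) *: 1 + x = y by rewrite /GRing.scale /= mulr1 subrK.
rewrite /GRing.scale /= => H1.
have yx0 : 0 < `|y - x| by rewrite normr_gt0 subr_eq0.
rewrite -ler_pdivrMr // -normf_div.
rewrite distrC in H1; apply: le_trans H1; rewrite le_eqVlt; apply/orP; left.
apply/eqP; congr (`|_|); field; by rewrite subr_eq0.
Qed.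

End Derivatives.

Section LinearisingCoordinate.
Context {R : realType}.
Implicit Types (nu x y v C : R).

(* Affine image of [exp (- nu x)], normalised so that [nu = 0] is not
   exceptional. *)
Definition lincoord nu x : R := if nu == 0 then x else (1 - expR (- nu * x)) / nu.

Definition lincoord_inv nu v : R :=
  if nu == 0 then v else - ln (1 - nu * v) / nu.

Lemma expR_lincoord nu x : expR (- nu * x) = 1 - nu * lincoord nu x.
Proof.
rewrite /lincoord; case: eqP => [->|/eqP nu0].
  by rewrite oppr0 !mul0r expR0 subr0.
by field.
Qed.

Lemma lincoord0 nu : lincoord nu 0 = 0.
Proof. by rewrite /lincoord mulr0 expR0 subrr mul0r; case: ifP. Qed.

(** Translations act affinely on the coordinate. Hence a chord may be based at the origin, and
    collinearity does not depend on the base point. *)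
Lemma lincoordB nu x y :
  lincoord nu (x - y) = expR (nu * y) * (lincoord nu x - lincoord nu y).
Proof.
rewrite /lincoord; case: eqP => [->|/eqP nu0]; first by rewrite mul0r expR0 mul1r.
have -> : - nu * (x - y) = nu * y + - nu * x by ring.
have e1 : expR (nu * y) * expR (- nu * y) = 1.
  by rewrite -expRD mulNr subrr expR0.
rewrite expRD -mulrBl mulrA; congr (_ / nu).
rewrite mulrBr mulrBr -mulrBr; ring: e1.
Qed.

(** Needed for the inversion, which changes the sign of the exponent. *)
Lemma lincoordN nu x : lincoord (- nu) x = expR (nu * x) * lincoord nu x.
Proof.
rewrite /lincoord oppr_eq0; case: eqP => [->|/eqP nu0].
  by rewrite mul0r expR0 mul1r.
have e1 : expR (nu * x) * expR (- nu * x) = 1.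
  by rewrite -expRD mulNr subrr expR0.
rewrite opprK invrN mulrN -mulNr mulrA; congr (_ / nu).
rewrite mulrBr; ring: e1.
Qed.

Lemma lincoord_gt0 nu x : 0 < x -> 0 < lincoord nu x.
Proof.
move=> x0; rewrite /lincoord; have [nu0|nu0|nu0] := ltgtP nu 0; last by [].
- rewrite nmulr_lgt0 ?invr_lt0 // subr_lt0 -expR0 ltr_expR.
  by rewrite mulr_gt0 // oppr_gt0.
- rewrite divr_gt0 // subr_gt0 -expR0 ltr_expR.
  by rewrite nmulr_rlt0 // oppr_lt0.
Qed.

Lemma lincoord_lt nu : {homo lincoord nu : x y / x < y}.
Proof.
move=> x y xy; rewrite -subr_gt0 -(@pmulr_rgt0 _ (expR (nu * x))) ?expR_gt0 //.
by rewrite -lincoordB lincoord_gt0 // subr_gt0.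
Qed.

(** The coordinate is increasing for every [nu], so the sign of a chord can be read in it whatever
    the exponent. *)
Lemma sg_lincoordB nu x y :
  Num.sg (lincoord nu x - lincoord nu y) = Num.sg (x - y).
Proof.
have [xy|xy|->] := ltgtP x y; last by rewrite !subrr.
- by rewrite !ltr0_sg // subr_lt0 ?lincoord_lt.
- by rewrite !gtr0_sg // subr_gt0 ?lincoord_lt.
Qed.

Lemma sg_lincoord nu x : Num.sg (lincoord nu x) = Num.sg x.
Proof. by rewrite -[in RHS](subr0 x) -(sg_lincoordB nu) lincoord0 subr0. Qed.

Lemma lincoord_inj nu : injective (lincoord nu).
Proof.
by move=> x y /eqP; rewrite -subr_eq0 -sgr_eq0 sg_lincoordB sgr_eq0 subr_eq0 => /eqP.
Qed.

Lemma lincoord_invK nu v : 0 < 1 - nu * v -> lincoord nu (lincoord_inv nu v) = v.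
Proof.
rewrite /lincoord /lincoord_inv; case: eqP => [//|/eqP nu0 v0].
have -> : - nu * (- ln (1 - nu * v) / nu) = ln (1 - nu * v) by field.
by rewrite lnK //; field.
Qed.

Lemma lincoordK nu : cancel (lincoord nu) (lincoord_inv nu).
Proof.
move=> x; apply: (@lincoord_inj nu); rewrite lincoord_invK //.
by rewrite -expR_lincoord expR_gt0.
Qed.

Lemma is_derive_lincoord nu x :
  is_derive x 1 (lincoord nu) (expR (- nu * x)).
Proof.
rewrite /lincoord; case: eqP => [->|/eqP nu0].
  by rewrite oppr0 mul0r expR0; exact: der_id.
have := derM (derB (der_cst 1 x) (der_exp (der_scale (- nu) (der_id x))))
  (der_cst (nu^-1) x).
by congr is_derive; field.
Qed.

Lemma is_derive_lincoord_inv nu v : 0 < 1 - nu * v ->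
  is_derive v 1 (lincoord_inv nu) (1 - nu * v)^-1.
Proof.
rewrite /lincoord_inv; case: eqP => [->|/eqP nu0] v0.
  by rewrite mul0r subr0 invr1; exact: der_id.
have := derM (der_scale (-1) (@der_ln _ (fun y => 1 - nu * y) _ _ v0 (derB (der_cst 1 v) (der_scale nu (der_id v)))))
  (der_cst (nu^-1) v).
under eq_fun do rewrite mulN1r.
by congr is_derive; field; rewrite nu0 gt_eqF.
Qed.

Lemma lincoord_continuous nu : continuous (lincoord nu).
Proof. by move=> x; apply: der_continuous (is_derive_lincoord nu x). Qed.

Lemma lincoord_continuous_param x : continuous (fun nu => lincoord nu x).
Proof.
move=> nu.
have [->|nu0] := eqVneq nu 0; last first.
  rewrite /prop_for /continuous_at.
  have nearn0 : \forall m \near nu, m != 0.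
    by apply: open_nbhs_nbhs; split => //; exact: open_neq.
  have := derM (derB (der_cst 1 nu) (der_exp (derM (der_scale (-1) (der_id nu)) (der_cst x nu))))
    (derV nu0 (der_id nu)).
  move=> /der_continuous; rewrite /prop_for /continuous_at.
  rewrite /lincoord (negbTE nu0) !mulN1r => H.
  apply: cvg_trans H; apply: near_eq_cvg.
  by apply: filterS nearn0 => m /negbTE ->; rewrite mulN1r.
apply/cvgrPdist_le => e e0.
have -> : lincoord 0 x = x by rewrite /lincoord eqxx.
(* At exponent 0 the singularity is removable: [(1 - expR (- m * x)) / m] is minus the difference
   quotient at 0 of [m |-> expR (- m * x)], whose derivative there is [- x]. *)
have := derM (der_scale (-1) (der_id (0 : R))) (der_cst x 0).
move=> /der_exp /der_near /(_ e0); apply: filterS => m.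
rewrite mulr0 mul0r expR0 mul1r !subr0 mulr0 add0r mulr1 mulN1r.
rewrite /lincoord; case: eqP => [-> _|/eqP m0]; first by rewrite subrr normr0 ltW.
have m1 : 0 < `|m| by rewrite normr_gt0.
rewrite -ler_pdivrMr // -normf_div; congr (_ <= _).
by congr (`|_|); field.
Qed.

End LinearisingCoordinate.

Section TouchingParabolas.
Context {R : realType}.
Implicit Types (h f g : R -> R) (t p q : R).

(** Here [q] is half the second derivative of the parabola, whence the factors 2 below. *)
Definition touched_above h t0 p q :=
  \forall t \near t0, h t <= h t0 + p * (t - t0) + q * (t - t0) ^+ 2.

(** The second derivative is used at [t0] only. The slack [e] makes the derivative of [f] minus the
    quadratic change sign from nonnegative to nonpositive at [t0], so the mean value theorem puts a
    local maximum there. *)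
Lemma taylor_le f g t0 q (e : R) : 0 < e ->
  (\forall t \near t0, is_derive (t : R) 1 f (g t)) -> is_derive t0 1 g q ->
  \forall t \near t0, f t <= f t0 + g t0 * (t - t0) + (q + e) / 2 * (t - t0) ^+ 2.
Proof.
move=> e0 fg gq; have : nbhs t0 (fun t : R => is_derive t 1 f (g t) /\
    `|g t - g t0 - q * (t - t0)| <= e * `|t - t0|).
  exact: filterI fg (der_near gq e0).
move=> /nbhs_ballP[d /= d0 H].
apply/nbhs_ballP; exists d => //= t tt0.
pose F x := f x - (g t0 * (x - t0) + (q + e) / 2 * (x - t0) ^+ 2).
pose dF x := g x - g t0 - (q + e) * (x - t0).
have Fder x : ball t0 d x -> is_derive x 1 F (dF x).
  move=> /H [fx _].
  have xt0 : is_derive x 1 (fun y => y - t0) (1 - 0).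
    exact: derB (der_id x) (der_cst t0 x).
  have := derB fx (derD (der_scale (g t0) xt0) (der_scale ((q + e) / 2) (derM xt0 xt0))).
  by congr is_derive; rewrite /dF; field.
suff : F t <= F t0 by rewrite /F subrr expr0n /= !mulr0 addr0 subr0; lra.
have ballE x : ball t0 d x = (`|x - t0| < d) by rewrite /ball /= distrC.
have [tlt|tgt|->] := ltgtP t t0; last by [].
- have sub x : t <= x <= t0 -> ball t0 d x.
    by move: tt0; rewrite !ballE !ltr_norml; lra.
  have [||c /[!in_itv]/= ct Ec] := @MVT R F dF t t0 tlt.
  + by move=> x /[!in_itv]/= xt; apply: Fder; apply: sub; lra.
  + apply: derivable_within_continuous => x /[!in_itv]/= xt.
    by have [] := Fder x (sub x xt).
  have cb : ball t0 d c by apply: sub; lra.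
  have [_] := H c cb.
  rewrite (@ltr0_norm _ (c - t0)) ?subr_lt0; last by case/andP: ct.
  rewrite ler_norml => /andP[h1 _].
  suff : 0 <= dF c * (t0 - t) by lra.
  by apply: mulr_ge0; [rewrite /dF|]; lra.
- have sub x : t0 <= x <= t -> ball t0 d x.
    by move: tt0; rewrite !ballE !ltr_norml; lra.
  have [||c /[!in_itv]/= ct Ec] := @MVT R F dF t0 t tgt.
  + by move=> x /[!in_itv]/= xt; apply: Fder; apply: sub; lra.
  + apply: derivable_within_continuous => x /[!in_itv]/= xt.
    by have [] := Fder x (sub x xt).
  have cb : ball t0 d c by apply: sub; lra.
  have [_] := H c cb.
  rewrite (@gtr0_norm _ (c - t0)) ?subr_gt0; last by case/andP: ct.
  rewrite ler_norml => /andP[_ h1].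
  suff : 0 <= - dF c * (t - t0) by lra.
  by apply: mulr_ge0; [rewrite /dF|]; lra.
Qed.


End TouchingParabolas.

(** * Comparison with exact solutions *)

Section ExactSolutions.
Context {R : realType} (nu C h1 t1 : R).
Implicit Types t : R.

(* The solution of [h'' = - nu h' (1 - h')] with value [h1] and slope [C] at
   [t1], as long as [exact_den] is positive. *)
Definition exact_den t := 1 - nu * (C * lincoord nu (t - t1)).
Definition exact_sol t := h1 + lincoord_inv nu (C * lincoord nu (t - t1)).
Definition exact_slope t := C * expR (- nu * (t - t1)) / exact_den t.

Let der_arg t : is_derive t 1 (fun t => C * lincoord nu (t - t1))
  (C * expR (- nu * (t - t1))).
Proof.
have := der_comp (g := fun t => t - t1) (is_derive_lincoord nu (t - t1))
  (derB (der_id t) (der_cst t1 t)).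
by move=> /(der_scale C); rewrite subr0 mulr1.
Qed.

Lemma exact_sol_lincoord t : 0 < exact_den t ->
  lincoord nu (exact_sol t - h1) = C * lincoord nu (t - t1).
Proof. by move=> t0; rewrite /exact_sol addrC addKr lincoord_invK. Qed.

Lemma is_derive_exact_sol t : 0 < exact_den t ->
  is_derive t 1 exact_sol (exact_slope t).
Proof.
move=> t0.
have := derD (der_cst h1 t) (der_comp (g := fun t => C * lincoord nu (t - t1))
  (is_derive_lincoord_inv t0) (der_arg t)).
by rewrite add0r mulrC.
Qed.

(** Together with the formula for [exact_slope], this shows that the signs of the slope and of one
    minus the slope are those of [C] and [1 - C]: an exact solution never leaves its regime. *)
Lemma exact_slopeB t : 0 < exact_den t -> 1 - exact_slope t = (1 - C) / exact_den t.
Proof.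
move=> t0; rewrite /exact_slope expR_lincoord; move: t0; rewrite /exact_den => t0.
by field; rewrite gt_eqF.
Qed.

Lemma is_derive_exact_slope t : 0 < exact_den t ->
  is_derive t 1 exact_slope (- nu * (exact_slope t * (1 - exact_slope t))).
Proof.
move=> t0; have den0 : exact_den t != 0 by rewrite gt_eqF.
have der_den := derB (der_cst 1 t) (der_scale nu (der_arg t)).
have der_num : is_derive t 1 (fun t => C * expR (- nu * (t - t1)))
    (C * (expR (- nu * (t - t1)) * (- nu * (1 - 0)))).
  exact: der_scale (der_exp (der_scale _ (derB (der_id t) (der_cst t1 t)))).
have := derM der_num (derV (f := exact_den) den0 der_den).
rewrite (exact_slopeB t0); congr is_derive.
rewrite /exact_slope expR_lincoord.
by move: den0; rewrite /exact_den => den0; field.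
Qed.

Lemma exact_den_near t : 0 < exact_den t -> \forall x \near t, 0 < exact_den x.
Proof.
move=> t0.
have := der_continuous (derB (der_cst 1 t) (der_scale nu (der_arg t))).
by move=> /cvgr_gt; apply.
Qed.

End ExactSolutions.

Section Comparison.
Context {R : realType}.
Implicit Types (h : R -> R) (t p q nu m s : R).

(* [s1] and [s2] are the signs of [p] and [1 - p]; they single out one of the
   regimes [0 < p < 1], [1 < p] and [p < 0]. *)
Definition supersol_in (J : set R) s1 s2 nu h :=
  forall t0 p q, J t0 -> Num.sg p = s1 -> Num.sg (1 - p) = s2 ->
    touched_above h t0 p q -> - nu * (p * (1 - p)) <= 2 * q.

(* The barrier is the exact solution of exponent [m] through the two end points;
   the sign of [(m - nu) * (s1 * s2)] makes it a strict supersolution. *)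
Lemma comparison s1 s2 nu m h t1 t2 :
  {in `[t1, t2], continuous h} ->
  supersol_in `]t1, t2[%classic s1 s2 nu h ->
  0 < (m - nu) * (s1 * s2) ->
  Num.sg (h t2 - h t1) = s1 -> Num.sg (t2 - t1 - (h t2 - h t1)) = s2 ->
  forall t, t1 < t < t2 ->
  lincoord m (h t - h t1) * lincoord m (t2 - t1)
    <= lincoord m (h t2 - h t1) * lincoord m (t - t1).
Proof.
move=> hc hsup mnu sg1 sg2 t tt.
rewrite leNgt; apply/negP => contra.
have t12 : t1 < t2 by case/andP: tt; exact: lt_trans.
set X := h t2 - h t1 in sg1 sg2 contra; set T := t2 - t1 in sg2 contra.
have T0 : 0 < lincoord m T by rewrite lincoord_gt0 // subr_gt0.
(* The slope at [t1] for which the exact solution of exponent [m] ends at [h t2]. *)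
pose C := lincoord m X / lincoord m T.
have CT : C * lincoord m T = lincoord m X by rewrite /C divfK // gt_eqF.
have sgC : Num.sg C = s1.
  by rewrite /C sgrM sg_lincoord sgrV (gtr0_sg T0) mulr1.
have sgC' : Num.sg (1 - C) = s2.
  have -> : 1 - C = (lincoord m T - lincoord m X) / lincoord m T.
    by rewrite -CT; field; rewrite gt_eqF.
  by rewrite sgrM sg_lincoordB sgrV (gtr0_sg T0) mulr1.
clearbody C.
(* In the coordinate the denominator is affine, so it is a convex combination of its end values 1
   and [expR (- m * X)], both positive. *)
have den x : t1 <= x <= t2 -> 0 < exact_den m C t1 x.
  move=> /andP[x1 x2]; rewrite /exact_den.
  set L := lincoord m (x - t1).
  have L0 : 0 <= L.
    by rewrite /L -sgr_ge0 sg_lincoord sgr_ge0 subr_ge0.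
  have L1 : L <= lincoord m T.
    rewrite /L -subr_ge0 -sgr_ge0 sg_lincoordB sgr_ge0 /T; lra.
  have eX := expR_gt0 (- m * X); rewrite expR_lincoord -CT in eX.
  rewrite -(@pmulr_lgt0 _ (lincoord m T)) //.
  have -> : (1 - m * (C * L)) * lincoord m T =
    (lincoord m T - L) + L * (1 - m * (C * lincoord m T)) by ring.
  have [LT|LT] := eqVneq L (lincoord m T).
    by rewrite LT subrr add0r mulr_gt0.
  by rewrite ltr_wpDr ?mulr_ge0 ?(ltW eX)// subr_gt0 lt_neqAle LT.
pose H := exact_sol m C (h t1) t1.
have Ht1 : H t1 = h t1.
  by rewrite /H /exact_sol subrr lincoord0 mulr0 -[X in lincoord_inv _ X](lincoord0 m) lincoordK addr0.
have Ht2 : H t2 = h t2.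
  by rewrite /H /exact_sol -/T CT lincoordK /X addrC subrK.
pose f x := h x - H x.
have fc : {within `[t1, t2], continuous f}.
  apply: continuous_in_subspaceT => x /set_mem /= xt.
  have xt' := xt; rewrite in_itv /= in xt'.
  apply: continuousB; first exact: hc.
  exact: der_continuous (is_derive_exact_sol _ (den x xt')).
have [c /[!in_itv]/= c12 cmax] := EVT_max (ltW t12) fc.
(* The negated conclusion puts [h] above the barrier at [t]; since [f] vanishes at both ends, its
   maximum is positive and interior. *)
have ft : 0 < f t.
  have Ht : lincoord m (H t - h t1) = C * lincoord m (t - t1).
    by apply: exact_sol_lincoord; apply: den; lra.
  rewrite -sgr_gt0 (_ : f t = h t - h t1 - (H t - h t1)); last by rewrite /f; ring.
  rewrite -(sg_lincoordB m) sgr_gt0 subr_gt0 Ht -(ltr_pM2r T0).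
  by rewrite mulrAC CT.
have fc0 : 0 < f c.
  by apply: lt_le_trans ft (cmax t _); rewrite in_itv /= !ltW //; case/andP: tt.
have c1 : t1 < c.
  rewrite lt_neqAle; case/andP: c12 => -> _; rewrite andbT.
  by apply/eqP => tc; move: fc0; rewrite -tc /f Ht1 subrr ltxx.
have c2 : c < t2.
  rewrite lt_neqAle; case/andP: c12 => _ ->; rewrite andbT.
  by apply/eqP => tc; move: fc0; rewrite tc /f Ht2 subrr ltxx.
have dc := den c c12.
set P := exact_slope m C t1 c.
have sgP : Num.sg P = s1.
  by rewrite /P /exact_slope !sgrM sgrV (gtr0_sg dc) (gtr0_sg (expR_gt0 _)) !mulr1.
have sgP' : Num.sg (1 - P) = s2.
  by rewrite /P exact_slopeB // sgrM sgrV (gtr0_sg dc) mulr1.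
(* At the maximum [c] of [h - H], the Taylor parabola of [H], raised to the height [h c], lies above
   [h]. *)
have touch e : 0 < e -> touched_above h c P ((- m * (P * (1 - P)) + e) / 2).
  move=> e0.
  have nearder : \forall x \near c, is_derive (x : R) 1 H (exact_slope m C t1 x).
    by apply: filterS (exact_den_near dc) => x; exact: is_derive_exact_sol.
  have := taylor_le e0 nearder (is_derive_exact_slope dc).
  have : \forall x \near c, x \in `]t1, t2[.
    by apply: near_in_itvoo; rewrite in_itv /= c1.
  apply: filterS2 => x /[!in_itv]/= /andP[x1 x2] le1.
  have : f x <= f c by apply: cmax; rewrite in_itv /= (ltW x1) (ltW x2).
  rewrite /f.
  by rewrite -/P in le1; lra.
have key e : 0 < e -> (m - nu) * (P * (1 - P)) <= e.
  move=> e0; have := hsup c P _ _ sgP sgP' (touch e e0).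
  by rewrite /= in_itv /= c1 c2 => /(_ isT); lra.
have : 0 < (m - nu) * (P * (1 - P)).
  have e1 : s1 * `|P| = P by rewrite -sgP -numEsg.
  have e2 : s2 * `|1 - P| = 1 - P by rewrite -sgP' -numEsg.
  rewrite -[P * (1 - P)](_ : s1 * `|P| * (s2 * `|1 - P|) = _); last by rewrite e1 e2.
  have -> : (m - nu) * (s1 * `|P| * (s2 * `|1 - P|)) =
    (m - nu) * (s1 * s2) * (`|P| * `|1 - P|) by ring.
  apply: mulr_gt0 => //; rewrite mulr_gt0 // normr_gt0.
    by apply: contraTN mnu => /eqP P0; rewrite -sgP P0 sgr0 mul0r mulr0 ltxx.
  by apply: contraTN mnu => /eqP P0; rewrite -sgP' P0 sgr0 !mulr0 ltxx.
move=> pos; have := key _ (divr_gt0 pos (ltr0Sn _ 1)); lra.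
Qed.

End Comparison.

Section Limits.
Context {R : realType}.

(** Comparison is available for [m] strictly on one side of [nu]; the sign of [s] selects that
    side. *)
Lemma le0_one_sided_limit (F : R -> R) (nu s : R) : {for nu, continuous F} ->
  s != 0 -> (forall m, 0 < (m - nu) * s -> F m <= 0) -> F nu <= 0.
Proof.
move=> Fc s0 H; rewrite leNgt; apply/negP => F0.
have /nbhs_ballP[e /= e0 He] : nbhs nu (fun m => 0 < F m) by exact: cvgr_gt Fc _ F0.
have s1 : 0 < `|s| by rewrite normr_gt0.
pose m := nu + e / 2 * (s / `|s|).
have : ball nu e m.
  have s2 : `|s / `|s| | = 1 by rewrite normf_div normr_id divff // gt_eqF.
  rewrite /ball /= /m opprD addNKr normrN normrM s2 mulr1 ger0_norm; lra.
move=> /He; rewrite ltNge H //.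
have -> : (m - nu) * s = e / 2 * (s ^+ 2 / `|s|) by rewrite /m; ring.
by apply: mulr_gt0; apply: divr_gt0 => //; rewrite exprn_even_gt0.
Qed.

(** If [f b] differed from [f a], the intermediate value theorem would give a value of [f] different
    from [f a] but close enough to it to lie in [P]. *)
Lemma locally_constant_value (f : R -> R) (P : set R) (a b : R) :
  (forall t, Num.min a b <= t <= Num.max a b -> {for t, continuous f}) ->
  nbhs (f a) P ->
  (forall t, Num.min a b <= t <= Num.max a b -> P (f t) -> f t = f a) ->
  f b = f a.
Proof.
move=> fc Pa Pconst; apply/eqP/negPn/negP => fba.
pose g (x : R) := f a + x * (f b - f a).
have gc : g x @[x --> 0^'+] --> f a.
  apply: cvg_at_right_filter.
  have : {for 0, continuous g}.
    exact: der_continuous (derD (der_cst (f a) 0) (derM (der_id 0) (der_cst (f b - f a) 0))).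
  by rewrite /prop_for /continuous_at {2}/g mul0r addr0.
near (0 : R)^'+ => x.
have x0 : 0 < x by [].
have x1 : x < 1 by near: x; exact: nbhs_right_lt.
have Pg : P (g x) by near: x; exact: gc Pa.
have mM : Num.min a b <= Num.max a b by rewrite ge_min le_max lexx.
have fw : {within `[Num.min a b, Num.max a b], continuous f}.
  by apply: continuous_in_subspaceT => t /set_mem /=; rewrite in_itv /=; exact: fc.
have [|t /[!in_itv]/= tab ft] := @IVT R f _ _ (g x) mM fw.
  by rewrite /g; case: (lerP a b) => _; case: (lerP (f a) (f b)) => ?; nra.
have := Pconst t tab; rewrite ft => /(_ Pg); rewrite /g => /eqP.
rewrite -subr_eq0 addrAC subrr add0r mulf_eq0 subr_eq0 (negbTE fba) orbF.
by rewrite gt_eqF.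
Unshelve. all: by end_near. Qed.

End Limits.

(** * Equality between the end points of one chord *)

Section Collinearity.
Context {R : realType}.
Implicit Types (h : R -> R) (J : set R) (t p q nu m s : R).

Definition touched_below h t0 p q :=
  \forall t \near t0, h t0 + p * (t - t0) + q * (t - t0) ^+ 2 <= h t.

Definition subsol_in J s1 s2 nu h :=
  forall t0 p q, J t0 -> Num.sg p = s1 -> Num.sg (1 - p) = s2 ->
    touched_below h t0 p q -> 2 * q <= - nu * (p * (1 - p)).

(* The inversion [x / |x|^2] acts as [h t |-> t - h t]. *)
Lemma supersol_reflect J s1 s2 nu h :
  subsol_in J s1 s2 nu h -> supersol_in J s2 s1 (- nu) (fun t => t - h t).
Proof.
move=> H t0 p q Jt sg1 sg2 touch.
have -> : p = 1 - (1 - p) by ring.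
have := H t0 (1 - p) (- q) Jt sg2.
rewrite [1 - (1 - p)]subKr => /(_ sg1) H1.
suff /H1 : touched_below h t0 (1 - p) (- q) by lra.
by apply: filterS touch => t; lra.
Qed.

(** One inequality is the limit of [comparison] for [h], the other that for [t - h t]; the two
    limits approach [nu] from opposite sides. Cross-multiplied expressions make both sides
    continuous in the exponent. *)
Lemma collinear J s1 s2 nu h t1 t2 :
  {in `[t1, t2], continuous h} -> `]t1, t2[ `<=` J ->
  supersol_in J s1 s2 nu h -> subsol_in J s1 s2 nu h ->
  s1 * s2 != 0 ->
  Num.sg (h t2 - h t1) = s1 -> Num.sg (t2 - t1 - (h t2 - h t1)) = s2 ->
  forall t, t1 < t < t2 ->
  (lincoord nu (h t) - lincoord nu (h t1)) * (lincoord nu t2 - lincoord nu t1) =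
  (lincoord nu (h t2) - lincoord nu (h t1)) * (lincoord nu t - lincoord nu t1).
Proof.
move=> hc tJ hsup hsub s0 sg1 sg2 t tt.
have lc m x y : lincoord m x - lincoord m y = expR (- m * y) * lincoord m (x - y).
  by rewrite lincoordB mulrA -expRD mulNr addNr expR0 mul1r.
rewrite !lc; suff : lincoord nu (h t - h t1) * lincoord nu (t2 - t1)
    = lincoord nu (h t2 - h t1) * lincoord nu (t - t1).
  move=> e; transitivity (expR (- nu * h t1) * expR (- nu * t1) *
    (lincoord nu (h t - h t1) * lincoord nu (t2 - t1))); first by ring.
  by rewrite e; ring.
have lcc (x y z w : R) : continuous
    (fun m => lincoord m x * lincoord m y - lincoord m z * lincoord m w).
  move=> m; apply: cvgB; apply: cvgM; exact: lincoord_continuous_param.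
apply/eqP; rewrite eq_le; apply/andP; split.
  rewrite -subr_le0; apply: (le0_one_sided_limit (lcc _ _ _ _ nu) s0) => m mnu.
  rewrite subr_le0; apply: (comparison (nu := nu) hc _ mnu sg1 sg2 tt).
  by move=> t0 p q /tJ; exact: hsup.
have ineq m : 0 < (m - - nu) * (s2 * s1) ->
    lincoord (- m) (h t2 - h t1) * lincoord (- m) (t - t1) -
    lincoord (- m) (h t - h t1) * lincoord (- m) (t2 - t1) <= 0.
  move=> mnu.
  have := @comparison R s2 s1 (- nu) m (fun t => t - h t) t1 t2.
  have -> : t2 - h t2 - (t1 - h t1) = t2 - t1 - (h t2 - h t1) by ring.
  have -> : t2 - t1 - (t2 - t1 - (h t2 - h t1)) = h t2 - h t1 by ring.
  move=> /(_ _ _ mnu sg2 sg1 t tt).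
  have -> : t - h t - (t1 - h t1) = t - t1 - (h t - h t1) by ring.
  (* Rewritten with exponent [- m], both sides of the reflected inequality contain the product of
     the two time increments. It cancels, and the desired inequality remains up to the factor
     [E1 * E2]. *)
  have lcN x : lincoord m x = expR (- m * x) * lincoord (- m) x.
    by rewrite lincoordN mulrA -expRD mulNr addrC subrr expR0 mul1r.
  have lcB x y : lincoord m (x - y) =
      expR (- m * x) * (lincoord (- m) x - lincoord (- m) y).
    rewrite lcN lincoordB mulrA -expRD; congr (expR _ * _); ring.
  rewrite !(lcB (_ - _) (_ - _)) !(lcN (_ - _)).
  set L := lincoord (- m); set E1 := expR _; set E2 := expR _ => H.
  have E12 : 0 < E1 * E2 by rewrite mulr_gt0 ?expR_gt0.
  rewrite -(pmulr_rle0 _ E12).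
  suff : E1 * (L (t - t1) - L (h t - h t1)) * (E2 * L (t2 - t1)) <=
         E2 * (L (t2 - t1) - L (h t2 - h t1)) * (E1 * L (t - t1)) by lra.
  apply: H; last by move=> x p q /tJ; exact: supersol_reflect.
  by move=> x /hc xc; apply: cvgB => //; exact: cvg_id.
rewrite -subr_le0; apply: (le0_one_sided_limit (s := - (s1 * s2)) (lcc _ _ _ _ nu)).
  by rewrite oppr_eq0.
move=> m mnu; rewrite -[m]opprK; apply: ineq.
by move: mnu; rewrite (mulrC s2); lra.
Qed.


End Collinearity.

(** * Classification of the profiles *)

Section Extension.
Context {R : realType}.
Implicit Types (h : R -> R) (J : set R) (t p q nu m s : R).

Definition slope nu h s t :=
  (lincoord nu (h t) - lincoord nu (h s)) / (lincoord nu t - lincoord nu s).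

(* The sign conditions of [supersol_in], on the difference quotient of [h]. *)
Definition in_regime s1 s2 h s t :=
  Num.sg ((h t - h s) * (t - s)) = s1 /\
  Num.sg ((t - s - (h t - h s)) * (t - s)) = s2.

Lemma in_regimeC s1 s2 h s t : in_regime s1 s2 h s t -> in_regime s1 s2 h t s.
Proof.
rewrite /in_regime; have -> : (h s - h t) * (s - t) = (h t - h s) * (t - s) by ring.
by have -> : (s - t - (h s - h t)) * (s - t) =
    (t - s - (h t - h s)) * (t - s) by ring.
Qed.

Lemma slopeC nu h s t : slope nu h s t = slope nu h t s.
Proof. by rewrite /slope -opprB -[X in _ / X]opprB invrN mulrNN. Qed.

Lemma lincoordB_neq0 nu s t : s != t -> lincoord nu t - lincoord nu s != 0.
Proof. by rewrite -sgr_eq0 sg_lincoordB sgr_eq0 subr_eq0 eq_sym. Qed.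

Lemma slopeE nu h s t : s != t ->
  lincoord nu (h t) - lincoord nu (h s) =
  slope nu h s t * (lincoord nu t - lincoord nu s).
Proof. by move=> st; rewrite /slope divfK // lincoordB_neq0. Qed.

(** For a fixed base point [s] the regime is a condition on the single number [slope nu h s t]. When
    both signs are nonzero it is an open condition, which is what the continuity argument needs. *)
Lemma in_regimeE s1 s2 nu h s t : s != t ->
  in_regime s1 s2 h s t <-> Num.sg (slope nu h s t) = s1 /\
    Num.sg (expR (nu * s) - expR (nu * h s) * slope nu h s t) = s2.
Proof.
move=> st; rewrite /in_regime.
have -> : Num.sg ((h t - h s) * (t - s)) = Num.sg (slope nu h s t).
  by rewrite /slope !sgrM sgrV !sg_lincoordB.
suff -> : Num.sg ((t - s - (h t - h s)) * (t - s)) =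
  Num.sg (expR (nu * s) - expR (nu * h s) * slope nu h s t) by [].
rewrite sgrM -(sg_lincoordB nu (t - s) (h t - h s)) !lincoordB slopeE // mulrCA mulrA.
rewrite [slope _ _ _ _ * _]mulrC -mulrBl sgrM sg_lincoordB -mulrA -sgrM.
have ts0 : 0 < (t - s) * (t - s).
  by rewrite -expr2 exprn_even_gt0 //= subr_eq0 eq_sym.
by rewrite (gtr0_sg ts0) mulr1.
Qed.

Lemma nbhs_sg (f : R -> R) (x : R) : {for x, continuous f} -> f x != 0 ->
  \forall y \near x, Num.sg (f y) = Num.sg (f x).
Proof.
move=> fc; rewrite neq_lt => /orP[fx|fx].
  by apply: filterS (cvgr_lt _ fc _ fx) => y fy; rewrite !ltr0_sg.
by apply: filterS (cvgr_gt _ fc _ fx) => y fy; rewrite !gtr0_sg.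
Qed.

Lemma slope_continuous nu h s t : s != t -> {for t, continuous h} ->
  {for t, continuous (slope nu h s)}.
Proof.
move=> st hc; apply: cvgM.
  apply: cvgB; last exact: cvg_cst.
  by apply: continuous_comp hc _; exact: lincoord_continuous.
apply: cvgV; first exact: lincoordB_neq0.
by apply: cvgB; [exact: lincoord_continuous|exact: cvg_cst].
Qed.

Variables (J : set R) (h : R -> R) (s1 s2 nu : R).
Hypothesis J_itv : is_interval J.
Hypothesis hc : forall t, J t -> {for t, continuous h}.
Hypothesis hsup : supersol_in J s1 s2 nu h.
Hypothesis hsub : subsol_in J s1 s2 nu h.
Hypothesis s12 : s1 * s2 != 0.

Lemma slope_between_lt s t r : J s -> J t -> s < r < t ->
  in_regime s1 s2 h s t -> slope nu h s r = slope nu h s t.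
Proof.
move=> Js Jt srt [sg1 sg2].
have st : s < t by case/andP: srt; exact: lt_trans.
have ts0 : Num.sg (t - s) = 1 by rewrite gtr0_sg // subr_gt0.
rewrite !sgrM ts0 !mulr1 in sg1 sg2.
have sub : `[s, t] `<=` J.
  by move=> x /=; rewrite in_itv /= => sxt; exact: J_itv sxt.
have hcst : {in `[s, t], continuous h} by move=> x xst; apply: hc; exact: sub.
have oosub : `]s, t[ `<=` J.
  by move=> x xst; apply: sub; exact: subset_itv_oo_cc.
have := collinear hcst oosub hsup hsub s12 sg1 sg2 srt.
rewrite /slope => e; apply/eqP; rewrite eqr_div ?lincoordB_neq0 //; last by rewrite lt_eqF.
  by rewrite e.
by rewrite lt_eqF //; case/andP: srt.
Qed.

Lemma slope_between s t r : J s -> J t -> (s < r < t) || (t < r < s) ->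
  in_regime s1 s2 h s t -> slope nu h s r = slope nu h s t.
Proof.
move=> Js Jt /orP[|] srt reg; first exact: slope_between_lt.
have rs : r != s by rewrite lt_eqF //; case/andP: srt.
have st : s != t by rewrite gt_eqF //; case/andP: srt; exact: lt_trans.
have tr : t != r by rewrite lt_eqF //; case/andP: srt.
have e := slope_between_lt Jt Js srt (in_regimeC reg).
have e1 := slopeE nu h tr; rewrite e slopeC in e1.
have e2 := slopeE nu h st.
have sr : s != r by rewrite eq_sym.
apply: (mulIf (lincoordB_neq0 nu sr)); rewrite -slopeE //; lra.
Qed.

(** The far end of the chord runs from [t] to [r]. Where the slope satisfies the open condition [P],
    the longer chord is itself in the regime, so [slope_between] forces its slope to be that of the
    chord ending at [t]; [locally_constant_value] then excludes any change. *)
Lemma slope_beyond s t r : J s -> J r -> (s < t <= r) || (r <= t < s) ->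
  in_regime s1 s2 h s t -> slope nu h s r = slope nu h s t.
Proof.
move=> Js Jr str reg.
have Jt : J t.
  case/orP: str => /andP[a b]; first by apply: (J_itv Js Jr); rewrite (ltW a).
  by apply: (J_itv Jr Js); rewrite a (ltW b).
have st : s != t by case/orP: str => /andP[a b]; rewrite ?(lt_eqF a) ?(gt_eqF b).
have between x : Num.min t r <= x <= Num.max t r ->
    ((s < t <= x) && (x <= r)) || ((x <= t < s) && (r <= x)).
  by case/orP: str => /andP[a b]; case: (lerP t r) => c /andP[d e]; lra.
have Jx x : Num.min t r <= x <= Num.max t r -> J x /\ s != x.
  move=> /between /orP[] /andP[/andP[a b] c].
    split; first by apply: (J_itv Js Jr); rewrite c andbT ltW ?(lt_le_trans a).
    by rewrite lt_eqF // (lt_le_trans a).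
  split; first by apply: (J_itv Jr Js); rewrite c ltW ?(le_lt_trans a).
  by rewrite gt_eqF // (le_lt_trans a).
pose P (y : R) := Num.sg y = s1 /\ Num.sg (expR (nu * s) - expR (nu * h s) * y) = s2.
have [sg1 sg2] := (in_regimeE s1 s2 nu h st).1 reg.
have [s10 s20] : s1 != 0 /\ s2 != 0 by move: s12; rewrite mulf_eq0 negb_or => /andP.
apply: (@locally_constant_value R (slope nu h s) P t r).
- by move=> x /Jx[Jx' sx]; apply: slope_continuous => //; exact: hc.
- apply: filterI.
    have := @nbhs_sg id (slope nu h s t) (der_continuous (der_id _)).
    rewrite -sgr_eq0 sg1 => /(_ s10); exact.
  have := @nbhs_sg (fun y => expR (nu * s) - expR (nu * h s) * y) (slope nu h s t).
  rewrite -sgr_eq0 sg2; apply => //.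
  exact: der_continuous (derB (der_cst _ _) (der_scale _ (der_id _))).
- move=> x xtr Px; have [Jx' sx] := Jx x xtr.
  have [->//|xt] := eqVneq x t.
  apply/esym; apply: slope_between => //; last exact/(in_regimeE s1 s2 nu h sx).2.
  by move: (between x xtr); lra.
Qed.

Lemma collinear_everywhere t1 t2 : J t1 -> J t2 -> t1 < t2 ->
  in_regime s1 s2 h t1 t2 -> forall t, J t ->
  lincoord nu (h t) - lincoord nu (h t1) =
  slope nu h t1 t2 * (lincoord nu t - lincoord nu t1).
Proof.
move=> J1 J2 t12 reg t Jt.
have [tt|tt|->] := ltgtP t t1; last by rewrite !subrr mulr0.
  (* Points to the left of [t1] are reached with [t2] as base point, the chord running through
     [t1]. *)
  have t2t : t2 != t by rewrite gt_eqF // (lt_trans tt).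
  have t21 : t2 != t1 by rewrite gt_eqF.
  have := slopeE nu h t2t; have := slopeE nu h t21.
  rewrite (@slope_beyond t2 t1 t J2 Jt) //; first by rewrite slopeC; lra.
    by rewrite (ltW tt) t12 orbT.
  exact: in_regimeC.
have t1t : t1 != t by rewrite lt_eqF.
rewrite (slopeE nu h t1t); congr (_ * _).
have [t2t|t2t|->//] := ltgtP t t2.
  by apply: slope_between => //; rewrite tt t2t.
by apply: slope_beyond => //; rewrite t12 ltW.
Qed.

End Extension.

Section Classification.
Context {R : realType}.
Variables (J : set R) (h : R -> R).
Hypothesis J_itv : is_interval J.
Hypothesis hc : forall t, J t -> {for t, continuous h}.

Let hcst t1 t2 : J t1 -> J t2 -> {in `[t1, t2], continuous h}.
Proof. by move=> J1 J2 x /[!in_itv]/= xst; apply: hc; exact: J_itv xst. Qed.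

Let subJ t1 t2 : J t1 -> J t2 -> `]t1, t2[ `<=` J.
Proof.
move=> J1 J2 x /=; rewrite in_itv /= => /andP[x1 x2].
by apply: (J_itv J1 J2); rewrite !ltW.
Qed.

Lemma expRN_le_half (x : R) : 1 <= x -> expR (- x) <= 1 / 2.
Proof.
move=> x1; have := expR_ge1Dx x => H; rewrite expRN div1r lef_pV2 ?posrE ?expR_gt0//.
lra.
Qed.

(* No parabola touches [h] from above in this regime, so the exponent [m] is
   free. *)
Lemma comparison_vacuous s1 s2 t1 t2 (m t : R) :
  s1 * s2 = -1 -> (forall nu, supersol_in J s1 s2 nu h) -> 0 < m ->
  J t1 -> J t2 ->
  Num.sg (h t2 - h t1) = s1 -> Num.sg (t2 - t1 - (h t2 - h t1)) = s2 ->
  t1 < t < t2 ->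
  (1 - expR (- m * (h t - h t1))) * (1 - expR (- m * (t2 - t1)))
    <= (1 - expR (- m * (h t2 - h t1))) * (1 - expR (- m * (t - t1))).
Proof.
move=> s12 sup m0 J1 J2 sg1 sg2 tt.
(* Since [s1 * s2 = -1], any exponent larger than [m] makes the barrier strict; [m + 1] is one. *)
have sup' : supersol_in `]t1, t2[%classic s1 s2 (m + 1) h.
  by move=> x p q /(subJ J1 J2); exact: sup.
have mm : 0 < (m - (m + 1)) * (s1 * s2) by rewrite s12; lra.
have := comparison (hcst J1 J2) sup' mm sg1 sg2 tt.
have expE x : 1 - expR (- m * x) = m * lincoord m x.
  by rewrite expR_lincoord; ring.
rewrite !expE => H.
have m2 : 0 < m * m by rewrite mulr_gt0.
suff : m * m * (lincoord m (h t - h t1) * lincoord m (t2 - t1)) <=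
   m * m * (lincoord m (h t2 - h t1) * lincoord m (t - t1)) by lra.
by rewrite ler_pM2l.
Qed.

(** For large [m] the barrier of a chord steeper than 1 follows the line of slope 1 until close to
    [t2] and jumps only there. So [h] cannot rise above that line earlier, but by continuity it has
    half of its final excess [2 * g] at some interior [t]. *)
Lemma slope_le1 t1 t2 : (forall nu, supersol_in J 1 (-1) nu h) ->
  J t1 -> J t2 -> t1 < t2 -> h t2 - h t1 <= t2 - t1.
Proof.
move=> sup J1 J2 t12; rewrite leNgt; apply/negP => XT.
pose g := (h t2 - h t1 - (t2 - t1)) / 2.
have g0 : 0 < g by rewrite /g; lra.
pose k (t : R) := h t - h t1 - (t - t1).
have kc : {within `[t1, t2], continuous k}.
  apply: continuous_in_subspaceT => x /set_mem /= xst.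
  apply: cvgB; apply: cvgB; try exact: cvg_cst; last exact: cvg_id.
  exact: hcst xst.
have [|t /[!in_itv]/= tab kt] := @IVT R k _ _ g (ltW t12) kc.
  by rewrite /k !subrr min_l ?max_r /g; lra.
have t1t : t1 < t.
  rewrite lt_neqAle; case/andP: tab => -> _; rewrite andbT.
  by apply/eqP => e; move: kt; rewrite -e /k !subrr; lra.
have tt2 : t < t2.
  rewrite lt_neqAle; case/andP: tab => _ ->; rewrite andbT.
  by apply/eqP => e; move: kt; rewrite e /k /g; lra.
(* Makes both [m * g] and [m * (t2 - t)] at least 1, so that the exponentials [u] and [v] below are
   at most 1/2 and [b * (u + v) <= b]. *)
pose m := g^-1 + (t2 - t)^-1.
have gi : 0 < g^-1 by rewrite invr_gt0.
have ti : 0 < (t2 - t)^-1 by rewrite invr_gt0 subr_gt0.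
have mg : 1 <= m * g.
  rewrite /m mulrDl mulVf ?gt_eqF // lerDl mulr_ge0 ?ltW //.
have mt : 1 <= m * (t2 - t).
  by rewrite /m mulrDl [X in _ + X]mulVf ?subr_eq0 ?gt_eqF // lerDr mulr_ge0 ?ltW // subr_gt0.
have m0 : 0 < m by rewrite addr_gt0.
have := @comparison_vacuous 1 (-1) t1 t2 m t.
rewrite mul1r => /(_ erefl sup m0 J1 J2).
rewrite gtr0_sg ?ltr0_sg; [|lra|lra] => /(_ erefl erefl).
rewrite t1t tt2 => /(_ isT).
have -> : h t - h t1 = (t - t1) + g by move: kt; rewrite /k; lra.
have -> : t2 - t1 = (t - t1) + (t2 - t) by ring.
rewrite (mulrDr _ (t - t1) g) (mulrDr _ (t - t1) (t2 - t)) !expRD.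
have b0 : 0 < expR (- m * (t - t1)) := expR_gt0 _.
have b1 : expR (- m * (t - t1)) < 1.
  by rewrite expR_lt1 mulNr oppr_lt0 mulr_gt0 // subr_gt0.
have u0 : 0 < expR (- m * g) := expR_gt0 _.
have u1 : expR (- m * g) <= 1 / 2 by rewrite mulNr expRN_le_half.
have v0 : 0 < expR (- m * (t2 - t)) := expR_gt0 _.
have v1 : expR (- m * (t2 - t)) <= 1 / 2 by rewrite mulNr expRN_le_half.
have e0 : 0 < expR (- m * (h t2 - h t1)) := expR_gt0 _.
move: b0 b1 u0 u1 v0 v1 e0.
move: (expR (- m * (t - t1))) (expR (- m * g)) (expR (- m * (t2 - t)))
  (expR (- m * (h t2 - h t1))) => b u v e b0 b1 u0 u1 v0 v1 e0.
have : 0 < b * u * (b * v) by rewrite !mulr_gt0.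
have : 0 < e * (1 - b) by rewrite mulr_gt0 ?subr_gt0.
have : b * (u + v) <= b by rewrite -[leRHS]mulr1 ler_pM2l //; lra.
lra.
Qed.

(** For large [m] the barrier of a decreasing chord drops almost to its end value right after [t1].
    This contradicts the point [t] where [h] is only halfway down; [m = (t - t1)^-1] is already
    large enough. *)
Lemma slope_ge0 t1 t2 : (forall nu, supersol_in J (-1) 1 nu h) ->
  J t1 -> J t2 -> t1 < t2 -> 0 <= h t2 - h t1.
Proof.
move=> sup J1 J2 t12; rewrite leNgt; apply/negP => X0.
have hw : {within `[t1, t2], continuous h}.
  by apply: continuous_in_subspaceT => x /set_mem /= xst; exact: hcst xst.
have [|t /[!in_itv]/= tab ht] := @IVT R h _ _ ((h t1 + h t2) / 2) (ltW t12) hw.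
  by rewrite min_r ?max_l; lra.
have t1t : t1 < t.
  rewrite lt_neqAle; case/andP: tab => -> _; rewrite andbT.
  by apply/eqP => e; move: ht; rewrite -e; lra.
have tt2 : t < t2.
  rewrite lt_neqAle; case/andP: tab => _ ->; rewrite andbT.
  by apply/eqP => e; move: ht; rewrite e; lra.
pose m := (t - t1)^-1.
have m0 : 0 < m by rewrite invr_gt0 subr_gt0.
have mt : 1 <= m * (t - t1) by rewrite mulVf // subr_eq0 gt_eqF.
have := @comparison_vacuous (-1) 1 t1 t2 m t.
rewrite mulr1 => /(_ erefl sup m0 J1 J2).
rewrite ltr0_sg ?gtr0_sg; [|lra|lra] => /(_ erefl erefl).
rewrite t1t tt2 => /(_ isT).
have -> : h t2 - h t1 = (h t - h t1) + (h t - h t1) by lra.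
rewrite (mulrDr _ (h t - h t1)) expRD.
have e1 : 1 < expR (- m * (h t - h t1)).
  by rewrite expR_gt1 mulNr oppr_gt0 pmulr_rlt0 //; lra.
have d0 : 0 < expR (- m * (t2 - t1)) := expR_gt0 _.
have d1 : expR (- m * (t - t1)) <= 1 / 2 by rewrite mulNr expRN_le_half.
move: e1 d0 d1; move: (expR (- m * (h t - h t1))) (expR (- m * (t2 - t1)))
  (expR (- m * (t - t1))) => e d d' e1 d0 d1.
have : 0 < (e - 1) * d by rewrite mulr_gt0 // subr_gt0.
have : 0 <= (e - 1) * (e + 1) * (1 / 2 - d') by rewrite !mulr_ge0 //; lra.
have : 0 < (e - 1) * (e - 1) by rewrite mulr_gt0 // subr_gt0.
lra.
Qed.

Definition collinear_from nu t1 sigma := forall t, J t ->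
  lincoord nu (h t) - lincoord nu (h t1) = sigma * (lincoord nu t - lincoord nu t1).

(** Increments over adjacent intervals add up, and a zero increment next to a full one would give an
    increment strictly between the two allowed values. *)
Lemma constant_of_differences (k : R -> R) :
  (forall s t, J s -> J t -> s < t -> k t - k s = 0 \/ k t - k s = t - s) ->
  forall t1 t2 t, J t1 -> J t2 -> J t -> t1 < t2 -> k t2 = k t1 -> k t = k t1.
Proof.
move=> H t1 t2 t J1 J2 Jt t12 k12.
have [tt|tt|->//] := ltgtP t t1.
  by have := H _ _ Jt J1 tt; have := H _ _ Jt J2 (lt_trans tt t12); lra.
have [t2t|t2t|->//] := ltgtP t t2.
  by have := H _ _ J1 Jt tt; have := H _ _ Jt J2 t2t; lra.
by have := H _ _ J1 Jt tt; have := H _ _ J2 Jt t2t; lra.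
Qed.

(** [fin] stands for the finiteness of [mu_minus]; in the other alternative of the hypothesis the
    exponent is arbitrary. Each of the three regimes is decided by one chord that lies in it.
    Profiles of constant slope 0 or 1 are put in the first case, whose sign conditions are therefore
    weak. *)
Lemma classification (fin : Prop) (nup num : R) :
  (exists t1 t2, [/\ J t1, J t2 & t1 < t2]) ->
  supersol_in J 1 1 nup h -> subsol_in J 1 1 nup h ->
  (fin /\ [/\ supersol_in J 1 (-1) num h, subsol_in J 1 (-1) num h,
              supersol_in J (-1) 1 num h & subsol_in J (-1) 1 num h]) \/
  (forall nu, supersol_in J 1 (-1) nu h /\ supersol_in J (-1) 1 nu h) ->
  exists2 t1, J t1 & exists sigma,
   [\/ [/\ 0 <= sigma, 0 <= expR (nup * t1) - expR (nup * h t1) * sigma &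
           collinear_from nup t1 sigma],
       [/\ fin, 0 < sigma, expR (num * t1) - expR (num * h t1) * sigma < 0 &
           collinear_from num t1 sigma] |
       [/\ fin, sigma < 0, 0 < expR (num * t1) - expR (num * h t1) * sigma &
           collinear_from num t1 sigma]].
Proof.
move=> [t1 [t2 [J1 J2 t12]]] supp subp H.
have one (x : R) : Num.sg x = 1 -> 0 < x by move=> e; rewrite -sgr_gt0 e.
have neg (x : R) : Num.sg x = -1 -> x < 0 by move=> e; rewrite -sgr_lt0 e ltrN10.
have reg s1 s2 s t : s < t -> Num.sg (h t - h s) = s1 ->
    Num.sg (t - s - (h t - h s)) = s2 -> in_regime s1 s2 h s t.
  move=> st a b; have ts : Num.sg (t - s) = 1 by rewrite gtr0_sg // subr_gt0.
  by rewrite /in_regime !sgrM ts !mulr1.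
have [[s [t [Js Jt st [lo hi]]]]|Nmid] := pselect (exists s t, [/\ J s, J t, s < t &
    0 < h t - h s /\ h t - h s < t - s]).
  have r : in_regime 1 1 h s t by apply: reg => //; rewrite gtr0_sg //; lra.
  exists s => //; exists (slope nup h s t).
  have nst : s != t by rewrite lt_eqF.
  have [/one a /one b] := (in_regimeE 1 1 nup h nst).1 r.
  constructor 1; split; [exact: ltW|exact: ltW|].
  by apply: (collinear_everywhere J_itv hc supp subp) => //; rewrite mul1r oner_neq0.
have [[s [t [Js Jt st hi]]]|Nhi] := pselect (exists s t, [/\ J s, J t, s < t &
    t - s < h t - h s]).
  case: H => [[f [sup sub _ _]]|sup]; last first.
    have {}sup nu := (sup nu).1; by have := slope_le1 sup Js Jt st; rewrite leNgt hi.
  have r : in_regime 1 (-1) h s t.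
    by apply: reg => //; [rewrite gtr0_sg//; lra|rewrite ltr0_sg//; lra].
  exists s => //; exists (slope num h s t).
  have nst : s != t by rewrite lt_eqF.
  have [/one a /neg b] := (in_regimeE 1 (-1) num h nst).1 r.
  constructor 2; split => //.
  by apply: (collinear_everywhere J_itv hc sup sub) => //; rewrite mul1r oppr_eq0 oner_neq0.
have [[s [t [Js Jt st lo]]]|Nlo] := pselect (exists s t, [/\ J s, J t, s < t &
    h t - h s < 0]).
  case: H => [[f [_ _ sup sub]]|sup]; last first.
    have {}sup nu := (sup nu).2; by have := slope_ge0 sup Js Jt st; rewrite leNgt lo.
  have r : in_regime (-1) 1 h s t.
    by apply: reg => //; [rewrite ltr0_sg//; lra|rewrite gtr0_sg//; lra].
  exists s => //; exists (slope num h s t).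
  have nst : s != t by rewrite lt_eqF.
  have [/neg a /one b] := (in_regimeE (-1) 1 num h nst).1 r.
  constructor 3; split => //.
  by apply: (collinear_everywhere J_itv hc sup sub) => //; rewrite mulr1 oppr_eq0 oner_neq0.
have two s t : J s -> J t -> s < t -> h t - h s = 0 \/ h t - h s = t - s.
  move=> Js Jt st.
  have [lo|lo|->] := ltgtP (h t - h s) 0; last by left.
    by exfalso; apply: Nlo; exists s, t.
  have [hi|hi|->] := ltgtP (h t - h s) (t - s); last by right.
    by exfalso; apply: Nmid; exists s, t.
  by exfalso; apply: Nhi; exists s, t.
exists t1 => //; have [h12|h12] := two _ _ J1 J2 t12.
  exists 0; constructor 1; split => //.
  move=> t Jt; rewrite mul0r (constant_of_differences two J1 J2 Jt t12) ?subrr //.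
  by move: h12; lra.
(* By [lincoordB], the coordinates of [h t] and [t] on a line of slope 1 have increments in this
   ratio; the second sign condition then holds with equality. *)
exists (expR (nup * (t1 - h t1))); constructor 1; split.
- by rewrite ltW // expR_gt0.
- rewrite -expRD (_ : nup * h t1 + _ = nup * t1) ?subrr //; ring.
- move=> t Jt.
  have two' s u : J s -> J u -> s < u ->
      u - h u - (s - h s) = 0 \/ u - h u - (s - h s) = u - s.
    by move=> Js Ju su; have := two _ _ Js Ju su; lra.
  have := constant_of_differences two' J1 J2 Jt t12; move=> ht.
  have ht1 : h t - h t1 = t - t1 by have := ht _; lra.
  have lc x y : lincoord nup x - lincoord nup y =
      expR (- nup * y) * lincoord nup (x - y).
    by rewrite lincoordB mulrA -expRD mulNr addNr expR0 mul1r.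
  rewrite !lc ht1 mulrA -expRD; congr (expR _ * _); ring.
Qed.

End Classification.

(** * The cone and its constants *)

Section Cone.
Context {R : realType} {n : nat} (G : set 'rV[R]_n).
Hypothesis n0 : (0 < n)%N.
Hypothesis Gopen : open G.
Hypothesis Gconv : convex_set (G : set (convex_lmodType 'rV[R]_n)).
Hypothesis Gsym : symmetric_set G.
Hypothesis Gcone : cone_at0 G.
Hypothesis Gpos : [set l : 'rV[R]_n | forall i : 'I_n, 0 < l 0 i] `<=` G.
Hypothesis Gtrace : G `<=` [set l : 'rV[R]_n | 0 < \sum_(i < n) l 0 i].
Implicit Types (x y v l : 'rV[R]_n) (a b m e t : R).

Let cst_row e : 'rV[R]_n := const_mx e.

Lemma cone_add x y : G x -> G y -> G (x + y).
Proof.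
move=> Gx Gy.
have half_ge0 : 0 <= 2^-1 :> R by rewrite invr_ge0.
have half_le1 : 2^-1 <= 1 :> R by rewrite invf_le1 // ler1n.
pose half := Itv01 half_ge0 half_le1.
have := @Gconv x y half (mem_set Gx) (mem_set Gy).
rewrite inE /conv /= => /(Gcone (ltr0Sn R 1)).
have -> : unstable.onem 2^-1 = 2^-1 :> R by rewrite /unstable.onem; field.
by rewrite scalerDr !scalerA divff ?pnatr_eq0 // !scale1r.
Qed.

Lemma cone_near x : G x -> exists2 e, 0 < e &
  forall y, (forall i, `|y 0 i - x 0 i| < e) -> G y.
Proof.
move=> Gx; have /nbhs_ballP[e /= e0 H] : nbhs x G by exact: open_nbhs_nbhs.
exists e => // y yx; apply: H; split => // i j.
by rewrite ord1 /ball /= distrC.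
Qed.

Lemma cone_sub x : G x -> exists2 e, 0 < e & G (x - cst_row e).
Proof.
move=> /cone_near[e e0 H]; exists (e / 2); first by lra.
apply: H => i; rewrite !mxE addrAC subrr add0r normrN ger0_norm; lra.
Qed.

Lemma cone_add_ge0 x v : G x -> (forall i, 0 <= v 0 i) -> G (x + v).
Proof.
move=> /cone_sub[e e0 Gx] v0.
have -> : x + v = x - cst_row e + (v + cst_row e).
  by rewrite addrACA [- _ + _]addrC subrr addr0.
apply: cone_add => //; apply: Gpos => i /=; rewrite !mxE.
by have := v0 i; lra.
Qed.

(** A constant vector larger than the distance to a nearby point of [G] leads from that point into
    [G] through the positive orthant, so approach along the diagonal suffices. *)
Lemma closure_coneE l : closure G l <-> forall e, 0 < e -> G (l + cst_row e).
Proof.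
split=> [cl e e0|H].
  have [y [Gy yl]] : G `&` ball l e !=set0.
    by apply: cl; exact: nbhsx_ballx.
  have -> : l + cst_row e = y + (l + cst_row e - y) by rewrite addrCA subrr addr0.
  apply: cone_add => //; apply: Gpos => i /=; rewrite !mxE.
  by case: yl => _ /(_ 0 i); rewrite /ball /= ltr_norml; lra.
move=> B /nbhs_ballP[e /= e0 He].
exists (l + cst_row (e / 2)); split; first by apply: H; lra.
apply: He; split => // i j; rewrite !mxE /ball /= opprD addNKr normrN.
rewrite ger0_norm; lra.
Qed.

Lemma frontier_coneE l : frontier G l <-> closure G l /\ ~ G l.
Proof. by move/interior_id: Gopen => e; rewrite /frontier e. Qed.

Lemma col_perm_inv (S : set 'rV[R]_n) : symmetric_set S ->
  forall s l, S (col_perm s l) <-> S l.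
Proof.
move=> Ssym s l; split=> [/(Ssym s^-1%g)|]; last exact: Ssym.
by rewrite -col_permM mulVg col_perm1.
Qed.

Lemma closure_symmetric : symmetric_set (closure G).
Proof.
move=> s l /closure_coneE H; apply/closure_coneE => e /H /(Gsym s).
by congr G; apply/matrixP => i j; rewrite !mxE.
Qed.

Lemma compl_symmetric : symmetric_set (~` G).
Proof. by move=> s l /= nG /(col_perm_inv Gsym). Qed.

Lemma sum_head_tail a b : \sum_(i < n) head_tail n a b 0 i = a + (n%:R - 1) * b.
Proof.
case: n n0 => // k _; rewrite big_ord_recl mxE /=.
rewrite (eq_bigr (fun=> b)) => [|i _]; last by rewrite mxE.
by rewrite sumr_const card_ord -mulr_natl -natr1; ring.
Qed.

Lemma head_tail_scale t a b : t *: head_tail n a b = head_tail n (t * a) (t * b).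
Proof. by apply/matrixP => i j; rewrite !mxE; case: ifP. Qed.

Lemma head_tail_cone t a b : 0 < t ->
  G (head_tail n (t * a) (t * b)) <-> G (head_tail n a b).
Proof.
move=> t0; rewrite -head_tail_scale; split=> [/(Gcone (t := t^-1))|]; last exact: Gcone.
by rewrite invr_gt0 scalerA mulVf ?gt_eqF // scale1r; apply.
Qed.

Lemma head_tail_closure t a b : 0 < t ->
  closure G (head_tail n (t * a) (t * b)) <-> closure G (head_tail n a b).
Proof.
have scale s x : 0 < s -> closure G x -> closure G (s *: x).
  move=> s0 /closure_coneE H; apply/closure_coneE => e e0.
  have /H/(Gcone s0) : 0 < s^-1 * e by rewrite mulr_gt0 ?invr_gt0.
  congr G; apply/matrixP => i j; rewrite !mxE mulrDr mulVKf //.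
  by rewrite gt_eqF.
move=> t0; rewrite -head_tail_scale; split=> [/(scale t^-1)|]; last exact: scale.
by rewrite invr_gt0 scalerA mulVf ?gt_eqF // scale1r; apply.
Qed.

Lemma head_tail_mono a a' b b' : a <= a' -> b <= b' ->
  G (head_tail n a b) -> G (head_tail n a' b').
Proof.
move=> aa bb Gab.
have -> : head_tail n a' b' = head_tail n a b + (head_tail n a' b' - head_tail n a b).
  by rewrite addrCA subrr addr0.
apply: cone_add_ge0 => // i; rewrite !mxE; case: ifP => _; lra.
Qed.

(** The line of vectors with tail [b] meets [G] in a half-line: upward because nonnegative vectors
    may be added, bounded below by the trace, open because [G] is. A closure point below [m] is
    impossible, since mixing it with the vector of head [a0] would give a point of [G] on the same
    line below [m]. *)
Lemma head_tail_threshold a0 b : G (head_tail n a0 b) -> exists m,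
  [/\ - (n%:R - 1) * b <= m,
      forall a, G (head_tail n a b) <-> m < a &
      forall a, closure G (head_tail n a b) <-> m <= a].
Proof.
move=> G0.
pose E := [set a | G (head_tail n (- a) b)].
have Eub : ubound E ((n%:R - 1) * b).
  by move=> a /Gtrace /=; rewrite sum_head_tail; lra.
have Esup : has_sup E by split; [exists (- a0); rewrite /E /= opprK|exists ((n%:R - 1) * b)].
pose m := - sup E.
have sub1 a c : head_tail n a b - cst_row c = head_tail n (a - c) (b - c).
  by apply/matrixP => i j; rewrite !mxE; case: ifP.
have add1 a c : head_tail n a b + cst_row c = head_tail n (a + c) (b + c).
  by apply/matrixP => i j; rewrite !mxE; case: ifP.
have GE a : G (head_tail n a b) <-> m < a.
  split=> [Ga|ma].
    have [e e0] := cone_sub Ga; rewrite sub1 => Ge.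
    have : E (- (a - e)).
      by rewrite /E /= opprK; apply: head_tail_mono Ge; lra.
    by move=> /(ub_le_sup Esup.2); rewrite /m; lra.
  have [|c Ec] := @sup_adherent _ E (a - m) _ Esup; first by rewrite subr_gt0.
  rewrite /m opprK => ac; apply: head_tail_mono Ec; last by [].
  by move: ac; rewrite /m; lra.
exists m; split => //.
  have := sup_le_ub Esup.1 Eub; rewrite /m mulNr; lra.
move=> a; split=> [/closure_coneE H|ma].
  rewrite leNgt; apply/negP => am.
  have ma0 := (GE a0).1 G0.
  have [d d0 Gd] := cone_sub G0; rewrite sub1 in Gd.
  (* This weight combines the heads into the midpoint of [a] and [m]. The amount [th * d / (1 - th)]
     added to one vector makes up for the [d] subtracted from the other. *)
  pose th := (m - a) / (2 * (a0 - a)).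
  have a0a : 0 < 2 * (a0 - a) by lra.
  have th0 : 0 < th by rewrite divr_gt0 // subr_gt0.
  have th1 : 0 < 1 - th by rewrite subr_gt0 ltr_pdivrMr //; lra.
  have e0 : 0 < th * d / (1 - th) by rewrite divr_gt0 // mulr_gt0.
  have := cone_add (Gcone th0 Gd) (Gcone th1 (H _ e0)).
  have -> : th *: head_tail n (a0 - d) (b - d) +
      (1 - th) *: (head_tail n a b + cst_row (th * d / (1 - th))) =
      head_tail n ((m + a) / 2) b.
    apply/matrixP => i j; rewrite !mxE; case: ifP => _; last first.
      by field; rewrite gt_eqF.
    transitivity (a + th * (a0 - a)); first by field; rewrite gt_eqF.
    by rewrite /th; field; rewrite subr_eq0 gt_eqF //; lra.
  by rewrite GE; lra.
apply/closure_coneE => e e0; rewrite add1.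
have /GE : m < a + e by lra.
by apply: head_tail_mono; lra.
Qed.

Lemma frontier_threshold m b : (forall a, G (head_tail n a b) <-> m < a) ->
  (forall a, closure G (head_tail n a b) <-> m <= a) ->
  forall a, frontier G (head_tail n a b) <-> a = m.
Proof.
move=> GE clE a; rewrite frontier_coneE GE clE; split=> [[ma /negP]|->].
  by rewrite -leNgt => am; apply/eqP; rewrite eq_le am ma.
by rewrite lexx ltxx.
Qed.

(** The threshold for tail 1 is the only frontier point on its line, hence the value picked by
    [get]; scaling gives every positive tail. *)
Lemma mu_plus_spec : 0 <= mu_plus G <= n%:R - 1 /\
  forall a b, 0 < b ->
    (G (head_tail n a b) <-> - mu_plus G * b < a) /\
    (closure G (head_tail n a b) <-> - mu_plus G * b <= a).
Proof.
have Gab a b : 0 < a -> 0 < b -> G (head_tail n a b).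
  by move=> a0 b0; apply: Gpos => i /=; rewrite !mxE; case: ifP.
have [m [m1 GE clE]] := head_tail_threshold (Gab 1 1 ltr01 ltr01).
have fE := frontier_threshold GE clE.
have m0 : m <= 0.
  rewrite leNgt; apply/negP => m0; have := Gab m 1 m0 ltr01.
  by rewrite GE ltxx.
have -> : mu_plus G = - m.
  apply: get_unique => [|y [_ /fE]]; last by move=> <-; rewrite opprK.
  by split; [lra|rewrite opprK; exact/fE].
split; first by lra.
move=> a b b0.
have e : head_tail n a b = head_tail n (b * (a / b)) (b * 1).
  by rewrite mulr1 mulrCA divff ?mulr1 // gt_eqF.
by rewrite e head_tail_cone // head_tail_closure // GE clE opprK ltr_pdivlMr // ler_pdivlMr.
Qed.

Lemma mu_minus_spec :
  (mu_minus G = +oo%E /\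
     forall a b, b < 0 -> ~ closure G (head_tail n a b)) \/
  (exists m, [/\ mu_minus G = m%:E, n%:R - 1 <= m &
     forall a b, b < 0 ->
      (G (head_tail n a b) <-> - m * b < a) /\
      (closure G (head_tail n a b) <-> - m * b <= a)]).
Proof.
have add1 a b c : head_tail n a b + cst_row c = head_tail n (a + c) (b + c).
  by apply/matrixP => i j; rewrite !mxE; case: ifP.
have sub1 a b c : head_tail n a b - cst_row c = head_tail n (a - c) (b - c).
  by apply/matrixP => i j; rewrite !mxE; case: ifP.
rewrite /mu_minus; case: asboolP => [/frontier_coneE[_ nG]|nf]; [left|right].
  split=> // a b b0 /closure_coneE /(_ (- b)); rewrite oppr_gt0 => /(_ b0).
  rewrite add1 subrr => Gab.
  have ab0 : 0 < a - b by have := Gtrace Gab; rewrite /= sum_head_tail; lra.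
  by apply: nG; apply/(head_tail_cone _ _ ab0); rewrite mulr0 mulr1.
(* This vector is always in the closure, so off the frontier it lies in [G]; openness then allows
   its tail to become slightly negative. *)
have G10 : G (head_tail n 1 0).
  apply: contrapT => nG; apply: nf; apply/frontier_coneE; split=> //.
  apply/closure_coneE => e e0; rewrite add1; apply: Gpos => i /=.
  by rewrite mxE; case: ifP => _; lra.
have [e e0] := cone_sub G10; rewrite sub1 => Ge.
have {}Ge : G (head_tail n ((1 - e) / e) (-1)).
  apply/(head_tail_cone _ _ e0); rewrite mulrCA divff ?gt_eqF // mulr1 mulrN1.
  by rewrite sub0r in Ge.
have [m [m1 GE clE]] := head_tail_threshold Ge.
have fE := frontier_threshold GE clE.
exists m; split; last 1 first.
- move=> a b b0; have nb0 : 0 < - b by rewrite oppr_gt0.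
  have e1 : head_tail n a b = head_tail n (- b * (a / - b)) (- b * (-1)).
    by rewrite mulrN1 opprK mulrCA divff ?mulr1 // gt_eqF.
  rewrite e1 head_tail_cone // head_tail_closure // GE clE.
  by rewrite ltr_pdivlMr // ler_pdivlMr // mulNr mulrN.
- congr EFin; apply: get_unique => [|y [_ /fE]] //.
  by split; [lra|exact/fE].
- by move: m1; rewrite mulrN1 opprK.
Qed.

End Cone.

(** * Radial functions and their matrix A^u *)

Section DirectionalDerivatives.
Context {R : realType} {V : normedModType R}.
Implicit Types (f g : V -> R) (x v : V) (a b : R).

(** Reduces directional derivatives to one variable, where the chain rule is at hand. *)
Lemma is_derive_line f x v a :
  is_derive x v f a <-> is_derive (0 : R) 1 (fun t => f (t *: v + x)) a.
Proof.
have e : (fun h : R => h^-1 *: ((f \o shift x) (h *: v) - f x)) =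
  (fun h : R => h^-1 *: (((fun t => f (t *: v + x)) \o shift 0) (h *: 1) -
      f (0 *: v + x))).
  by apply/funext => h; rewrite /= addr0 scale0r add0r /GRing.scale /= mulr1.
split=> -[].
  by rewrite /derivable /derive e => d1 d2; apply: DeriveDef.
by rewrite /derivable /derive -e => d1 d2; apply: DeriveDef.
Qed.

Lemma is_derive_compR (g : R -> R) f x v a b :
  is_derive (f x) 1 g a -> is_derive x v f b ->
  is_derive x v (fun y => g (f y)) (a * b).
Proof.
move=> ga /is_derive_line fb; apply/is_derive_line.
apply: (der_comp (f := g) (g := fun t : R => f (t *: v + x))) fb.
by rewrite scale0r add0r.
Qed.

End DirectionalDerivatives.

(** * Stability of the class C^k on an open set *)

Section ClassCk.
Context {R : realType} {n : nat} (Om : set 'rV[R]_n).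
Hypothesis Om_open : open Om.
Implicit Types (f g : 'rV[R]_n -> R) (x : 'rV[R]_n) (k : nat).

Let Om_near x : Om x -> \forall y \near x, Om y.
Proof. by move=> Omx; exact: open_nbhs_nbhs. Qed.

Lemma partial_local f g i x : Om x -> (forall y, Om y -> f y = g y) ->
  partial i f x = partial i g x.
Proof.
move=> Omx fg; apply: near_eq_derive.
by apply: filterS (Om_near Omx) => y; exact: fg.
Qed.

Lemma Ck_continuous k f : Ck k Om f -> continuous_on Om f.
Proof. by case: k => [|k] //= []. Qed.

Lemma Ck_ext k f g : (forall y, Om y -> f y = g y) -> Ck k Om f -> Ck k Om g.
Proof.
have cext (f' g' : 'rV[R]_n -> R) : (forall y, Om y -> f' y = g' y) ->
    continuous_on Om f' -> continuous_on Om g'.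
  move=> fg fc x Omx; rewrite /prop_for /continuous_at -(fg x Omx).
  have nfg : \forall y \near x, f' y = g' y.
    by apply: filterS (Om_near Omx) => y; exact: fg.
  exact: cvg_trans (near_eq_cvg nfg) (fc x Omx).
elim: k f g => [|k IHk] f g fg /=; first exact: cext.
move=> [fc fd]; split; first exact: cext fg fc.
move=> i; have [d1 d2] := fd i; split=> [x Omx|].
  have nfg : \forall y \near x, f y = g y.
    by apply: filterS (Om_near Omx) => y; exact: fg.
  exact: near_eq_derivable nfg (d1 x Omx).
by apply: IHk d2 => y Omy; exact: partial_local.
Qed.

Lemma CkS_intro k f (df : 'I_n -> 'rV[R]_n -> R) : continuous_on Om f ->
  (forall i x, Om x -> is_derive x (delta_mx 0 i) f (df i x)) ->
  (forall i, Ck k Om (df i)) -> Ck k.+1 Om f.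
Proof.
move=> fc fd dfk; split=> // i; split=> [x Omx|]; first by have [] := fd i x Omx.
by apply: Ck_ext (dfk i) => y Omy; have [] := fd i y Omy.
Qed.

Lemma Ck_is_derive k f i x : Ck k.+1 Om f -> Om x ->
  is_derive x (delta_mx 0 i) f (partial i f x).
Proof. by move=> [_ /(_ i)[fd _]] Omx; apply: DeriveDef => //; exact: fd. Qed.

Lemma CkW k f : Ck k.+1 Om f -> Ck k Om f.
Proof.
elim: k f => [f []//|k IHk] f [fc fd]; split=> // i; have [d1 d2] := fd i.
by split => //; exact: IHk.
Qed.

Lemma Ck_cst k (a : R) : Ck k Om (fun=> a).
Proof.
elim: k a => [|k IHk] a; first by move=> x _; exact: cst_continuous.
apply: (@CkS_intro _ _ (fun _ _ => 0)).
- by move=> x _; exact: cst_continuous.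
- by move=> _; exact: IHk.
Qed.

Lemma Ck_coord k (j : 'I_n) : Ck k Om (fun x => x 0 j).
Proof.
case: k => [|k]; first by move=> x _; exact: coord_continuous.
apply: (@CkS_intro _ _ (fun i _ => (delta_mx 0 i : 'rV[R]_n) 0 j)).
- by move=> x _; exact: coord_continuous.
- move=> i x _; apply/is_derive_line.
  have := derD (derM (der_id 0) (der_cst ((delta_mx 0 i : 'rV[R]_n) 0 j) 0))
    (der_cst (x 0 j) 0).
  rewrite mulr0 add0r mulr1 addr0; congr is_derive.
  by apply/funext => t; rewrite !mxE.
- by move=> i; exact: Ck_cst.
Qed.

Lemma Ck_add k f g : Ck k Om f -> Ck k Om g -> Ck k Om (fun x => f x + g x).
Proof.
elim: k f g => [|k IHk] f g fk gk.
  by move=> x Omx; exact: (continuousD (fk x Omx) (gk x Omx)).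
apply: (@CkS_intro _ _ (fun i x => partial i f x + partial i g x)).
- by move=> x Omx; exact: (continuousD (fk.1 x Omx) (gk.1 x Omx)).
- move=> i x Omx.
  exact: is_deriveD (Ck_is_derive i fk Omx) (Ck_is_derive i gk Omx).
- by move=> i; apply: IHk; [exact: (fk.2 i).2|exact: (gk.2 i).2].
Qed.

Lemma Ck_mul k f g : Ck k Om f -> Ck k Om g -> Ck k Om (fun x => f x * g x).
Proof.
elim: k f g => [|k IHk] f g fk gk.
  by move=> x Omx; exact: (continuousM (fk x Omx) (gk x Omx)).
apply: (@CkS_intro _ _ (fun i x => f x * partial i g x + g x * partial i f x)).
- by move=> x Omx; exact: (continuousM (fk.1 x Omx) (gk.1 x Omx)).
- move=> i x Omx.
  exact: is_deriveM (Ck_is_derive i fk Omx) (Ck_is_derive i gk Omx).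
- move=> i; apply: Ck_add; apply: IHk; try exact: CkW.
    exact: (gk.2 i).2.
  exact: (fk.2 i).2.
Qed.

Lemma Ck_scale k a f : Ck k Om f -> Ck k Om (fun x => a * f x).
Proof. by move=> fk; apply: Ck_mul => //; exact: Ck_cst. Qed.

Lemma Ck_sum k (I : Type) (r : seq I) (F : I -> 'rV[R]_n -> R) :
  (forall i, Ck k Om (F i)) -> Ck k Om (fun x => \sum_(i <- r) F i x).
Proof.
move=> Fk; elim: r => [|i r IHr].
  by apply: Ck_ext (Ck_cst k 0) => y _; rewrite big_nil.
by apply: Ck_ext (Ck_add (Fk i) IHr) => y _; rewrite big_cons.
Qed.

Lemma Ck_exp k f : Ck k Om f -> Ck k Om (fun x => expR (f x)).
Proof.
elim: k f => [|k IHk] f fk.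
  move=> x Omx; apply: continuous_comp (fk x Omx) _; exact: continuous_expR.
apply: (@CkS_intro _ _ (fun i x => expR (f x) * partial i f x)).
- by move=> x Omx; apply: continuous_comp (fk.1 x Omx) _; exact: continuous_expR.
- move=> i x Omx.
  exact: is_derive_compR (is_derive_expR _) (Ck_is_derive i fk Omx).
- by move=> i; apply: Ck_mul; [apply: IHk; exact: CkW|exact: (fk.2 i).2].
Qed.

Lemma Ck_ln k f : (forall x, Om x -> 0 < f x) -> Ck k Om f ->
  Ck k Om (fun x => ln (f x)).
Proof.
move=> f0; elim: k => [|k IHk] fk.
  by move=> x Omx; apply: continuous_comp (fk x Omx) _; apply: continuous_ln; exact: f0.
(* Writing [1 / f] as [expR (- ln f)] lets the induction close with [Ck_exp] and the case of lower
   order, without a separate result on inverses. *)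
apply: (@CkS_intro _ _ (fun i x => expR (-1 * ln (f x)) * partial i f x)).
- by move=> x Omx; apply: continuous_comp (fk.1 x Omx) _; apply: continuous_ln; exact: f0.
- move=> i x Omx.
  have := is_derive_compR (is_derive1_ln (f0 x Omx)) (Ck_is_derive i fk Omx).
  by rewrite mulN1r expRN lnK // posrE f0.
- move=> i; apply: Ck_mul; last exact: (fk.2 i).2.
  by apply: Ck_exp; apply: Ck_scale; apply: IHk; exact: CkW.
Qed.

End ClassCk.

(** * Spectrum of a rank-one perturbation of a scalar matrix *)

Section CharPoly.

(** The matrix [Q] is made block triangular once from the right and once from the left, and the two
    values of its determinant are compared. The factor [a] on the left avoids inverting [a], which
    will be the polynomial ['X - al%:P]. *)
Lemma det_scalar_rank1 (A : comNzRingType) (n : nat) (a : A) (u : 'cV[A]_n)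
    (v : 'rV[A]_n) :
  a * \det (a%:M + u *m v) = a ^+ n * (a + (v *m u) 0 0).
Proof.
pose Q := block_mx (a%:M : 'M[A]_1) v (- u) (1%:M : 'M[A]_n).
have detQ : \det Q = a + (v *m u) 0 0.
  have : Q *m block_mx 1%:M 0 u 1%:M = block_mx (a%:M + v *m u) v 0 1%:M.
    by rewrite mulmx_block !mulmx1 !mulmx0 mul1mx add0r addNr add0r.
  move=> /(congr1 determinant); rewrite det_mulmx det_ublock det_lblock !det1 !mulr1.
  by move=> ->; rewrite det_mx11 !mxE eqxx mulr1n.
have : block_mx 1%:M 0 u a%:M *m Q = block_mx (a%:M : 'M[A]_1) v 0 (a%:M + u *m v).
  rewrite mulmx_block !mul1mx !mul0mx !addr0 mulmx1 mulmxN mul_scalar_mx mul_mx_scalar.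
  by rewrite subrr addrC.
move=> /(congr1 determinant); rewrite det_mulmx det_ublock det_lblock !det_scalar.
by rewrite detQ !expr1 mul1r => ->.
Qed.

Lemma eigenvalues_rank1 (R : realType) (n : nat) (al be : R) (x : 'rV[R]_n) :
  (0 < n)%N ->
  eigenvalues (\matrix_(i, j) (al * (i == j)%:R + be * (x 0 i * x 0 j)))
    (head_tail n (al + be * \sum_i x 0 i ^+ 2) al).
Proof.
case: n x => // k x _; rewrite /eigenvalues /char_poly.
set M := (X in char_poly_mx X).
pose u := map_mx polyC (- be *: x^T); pose v := map_mx polyC x.
have -> : char_poly_mx M = ('X - al%:P)%:M + u *m v.
  apply/matrixP => i j; rewrite !mxE big_ord1 !mxE.
  by case: (i == j); rewrite /= ?mulr1n ?mulr0n !polyCD !polyCM ?polyCN ?polyC1 ?polyC0; ring.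
have a0 : 'X - al%:P != 0 :> {poly R} by rewrite polyXsubC_eq0.
apply: (mulfI a0); rewrite det_scalar_rank1.
have -> : 'X - al%:P + (v *m u) 0 0 = 'X - (al + be * \sum_i x 0 i ^+ 2)%:P.
  rewrite !mxE (eq_bigr (fun i => (- be * (x 0 i ^+ 2))%:P)) => [|i _].
    rewrite -rmorph_sum -mulr_sumr /= polyCD mulNr polyCN; ring.
  by rewrite /u /v !mxE -polyCM; congr polyC; ring.
rewrite big_ord_recl mxE /=.
rewrite (eq_bigr (fun=> 'X - al%:P)) => [|i _]; last by rewrite mxE.
by rewrite prodr_const card_ord exprS; ring.
Qed.

Lemma eigenvalues_perm (R : realType) (n : nat) (M : 'M[R]_n) (l l' : 'rV[R]_n) :
  eigenvalues M l -> eigenvalues M l' -> exists s, l' = col_perm s l.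
Proof.
rewrite /eigenvalues => -> e.
pose t : n.-tuple R := [tuple l 0 i | i < n].
pose t' : n.-tuple R := [tuple l' 0 i | i < n].
have tE (m : 'rV[R]_n) : \prod_(x <- [tuple m 0 i | i < n]) ('X - x%:P) =
    \prod_(i < n) ('X - (m 0 i)%:P).
  by rewrite big_tuple; apply: eq_bigr => i _; rewrite tnth_mktuple.
have /tuple_permP[s ts] : perm_eq t' t.
  by apply: prod_XsubC_eq; rewrite !tE.
exists s; apply/matrixP => i j; rewrite ord1 mxE.
have : tnth t' j = tnth [tuple tnth t (s i) | i < n] j.
  by rewrite !(tnth_nth 0) ts.
by rewrite !tnth_mktuple.
Qed.

End CharPoly.

Section Radial.
Context {R : realType} {n : nat}.
Implicit Types (x y : 'rV[R]_n) (i j : 'I_n) (u : 'rV[R]_n -> R).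

Definition sqn x : R := \sum_i x 0 i ^+ 2.

Lemma sqn_ge0 x : 0 <= sqn x.
Proof. by apply: sumr_ge0 => i _; exact: sqr_ge0. Qed.

Lemma enorm_sqn x : enorm x ^+ 2 = sqn x.
Proof. by rewrite sqr_sqrtr // sqn_ge0. Qed.

Lemma Ck_sqn (Om : set 'rV[R]_n) k : open Om -> Ck k Om sqn.
Proof.
move=> Oo; apply: Ck_sum => // i.
by apply: (Ck_ext Oo _ (Ck_mul Oo (Ck_coord Oo k i) (Ck_coord Oo k i))) => y _.
Qed.

Lemma sqn_continuous : continuous sqn.
Proof.
by move=> x; apply: (Ck_continuous (Ck_sqn 0 (@openT _))).
Qed.

Lemma is_derive_coord x i j :
  is_derive x (delta_mx 0 i) (fun y : 'rV[R]_n => y 0 j) (i == j)%:R.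
Proof.
apply/is_derive_line.
have := derD (derM (der_id 0) (der_cst ((i == j)%:R : R) 0)) (der_cst (x 0 j) 0).
rewrite mulr0 add0r mulr1 addr0; congr is_derive.
by apply/funext => t; rewrite !mxE /= eq_sym.
Qed.

Lemma is_derive_sqn x i : is_derive x (delta_mx 0 i) sqn (2 * x 0 i).
Proof.
have := @is_derive_sum _ _ _ n (fun j (y : 'rV[R]_n) => y 0 j * y 0 j) x (delta_mx 0 i)
  (fun j => x 0 j *: (i == j)%:R + x 0 j *: (i == j)%:R)
  (fun j => is_deriveM (is_derive_coord x i j) (is_derive_coord x i j)).
have -> : \sum_(j < n) (x 0 j *: (i == j)%:R + x 0 j *: (i == j)%:R) = 2 * x 0 i.
  rewrite (bigD1 i) //= big1 => [|j ji].
    by rewrite addr0 eqxx /GRing.scale /= mulr1; ring.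
  by rewrite eq_sym (negbTE ji) /GRing.scale /= mulr0 addr0.
by congr is_derive; apply/funext => y; rewrite fct_sumE.
Qed.

Variables (x : 'rV[R]_n) (phi psi : R -> R) (q : R) (u : 'rV[R]_n -> R).
Hypothesis n3 : (3 <= n)%N.
Hypothesis x0 : 0 < sqn x.
Hypothesis ux : \forall y \near x,
  u y = expR (- ((n%:R - 2) / 2) * phi (ln (sqn y))).
Hypothesis der_phi :
  \forall t \near ln (sqn x), is_derive (t : R) 1 phi (psi t).
Hypothesis der_psi : is_derive (ln (sqn x)) 1 psi q.

Let c : R := - ((n%:R - 2) / 2).
Let lnS y : R := ln (sqn y).
Let s := sqn x.
Let p := psi (lnS x).

Let lnS_continuous : {for x, continuous lnS}.
Proof. by apply: continuous_comp; [exact: sqn_continuous|exact: continuous_ln]. Qed.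

Let is_derive_lnS y i : 0 < sqn y ->
  is_derive y (delta_mx 0 i) lnS ((sqn y)^-1 * (2 * y 0 i)).
Proof. by move=> y0; exact: is_derive_compR (is_derive1_ln y0) (is_derive_sqn y i). Qed.

Let U y : R := expR (c * phi (lnS y)).
Let dU j y : R := c * (U y * (psi (lnS y) * ((sqn y)^-1 * (2 * y 0 j)))).

Let is_derive_U : \forall y \near x, 0 < sqn y /\
  forall j, is_derive y (delta_mx 0 j) U (dU j y).
Proof.
have near1 : \forall y \near x, 0 < sqn y.
  exact: (cvgr_gt _ (@sqn_continuous x)).
have near2 : \forall y \near x, is_derive (lnS y) 1 phi (psi (lnS y)).
  exact: (lnS_continuous der_phi).
apply: filterS2 near1 near2 => y y0 dphi; split=> // j.
have := is_derive_compR (der_exp (der_scale c dphi)) (is_derive_lnS j y0).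
by congr is_derive; rewrite /dU /U; ring.
Qed.

Let partial_u : \forall y \near x, forall j, partial j u y = dU j y.
Proof.
have uU : \forall y \near x, \forall z \near y, u z = U z.
  exact: nbhs_interior ux.
apply: filterS2 uU is_derive_U => y uU [_ dUy] j.
by rewrite /partial (near_eq_derive _ uU); have [] := dUy j.
Qed.

Let partial_partial_u i j : partial i (partial j u) x =
  U x * (2 * c * p / s * (i == j)%:R +
         4 * c * (c * p ^+ 2 + q - p) / s ^+ 2 * (x 0 i * x 0 j)).
Proof.
have near1 : \forall y \near x, partial j u y = dU j y.
  by apply: filterS partial_u => y; apply.
rewrite /partial (near_eq_derive _ near1).
have [x0' dUx] := nbhs_singleton is_derive_U.
have dpsi := is_derive_compR (f := lnS) der_psi (is_derive_lnS i x0).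
have dinv : is_derive x (delta_mx 0 i) (fun y => (sqn y)^-1) (- (s ^- 2 * 1) * (2 * x 0 i)).
  apply: is_derive_compR (is_derive_sqn x i).
  by rewrite -mulNr; exact: derV (lt0r_neq0 x0) (der_id _).
have [_] : is_derive x (delta_mx 0 i) (dU j) _ := is_deriveM (is_derive_cst c x (delta_mx 0 i)) (is_deriveM (dUx i)
  (is_deriveM dpsi (is_deriveM dinv
    (is_deriveM (is_derive_cst (2 : R) x (delta_mx 0 i)) (is_derive_coord x i j))))).
rewrite /GRing.scale /= => ->.
by rewrite !fctE /dU /= -/p -/s; field; rewrite gt_eqF.
Qed.

(** The exponent is chosen so that [u] to the power [-4 / (n - 2)] is [expR (2 * phi)]. The
    remaining negative powers of [u] cancel those produced by the derivatives, leaving a scalar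
    matrix plus a multiple of [x^T x]. *)
Lemma Amx_radial : Amx u x = \matrix_(i, j)
  (2 * expR (2 * phi (ln (sqn x))) / s * (p * (1 - p)) * (i == j)%:R
   + 4 * expR (2 * phi (ln (sqn x))) / s ^+ 2 * (q - p + p ^+ 2) * (x 0 i * x 0 j)).
Proof.
have uE : u x = U x := nbhs_singleton ux.
have pE j : partial j u x = dU j x := nbhs_singleton partial_u j.
have U0 : 0 < U x := expR_gt0 _.
have N2 : 0 < n%:R - 2 :> R by rewrite subr_gt0 ltr_nat.
have powU r : U x `^ r = expR (r * (c * phi (lnS x))).
  by rewrite /powR gt_eqF // /U expRK.
apply/matrixP => i j; rewrite !mxE uE partial_partial_u !pE.
have -> : \sum_k partial k u x ^+ 2 = (2 * c * U x * p / s) ^+ 2 * s.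
  rewrite (eq_bigr (fun k => (2 * c * U x * p / s) ^+ 2 * (x 0 k ^+ 2))) => [|k _].
    by rewrite -mulr_sumr.
  by rewrite pE /dU -/s -/p; ring.
set E := expR (2 * phi (ln (sqn x))).
have e1 : U x `^ (- ((n%:R + 2) / (n%:R - 2))) = E / U x.
  rewrite powU /U -expRN -expRD; congr expR.
  by rewrite /c -/(lnS x); field; rewrite gt_eqF.
have e2 : U x `^ (- (2 * n%:R / (n%:R - 2))) = E / U x ^+ 2.
  rewrite powU /U -expRM_natl -expRN -expRD; congr expR.
  by rewrite /c -/(lnS x); field; rewrite gt_eqF.
rewrite e1 e2 /dU -/s -/p /c; field.
by rewrite !gt_eqF.
Qed.

End Radial.

(** * From viscosity solutions to profiles *)

Section RadialEigenvalues.
Context {R : realType} {n : nat}.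

(** Turns the existential [lambda_in] into a statement on whichever list of eigenvalues has been
    computed. *)
Lemma lambda_in_symmetric (M : 'M[R]_n) (S : set 'rV[R]_n) (l : 'rV[R]_n) :
  symmetric_set S -> lambda_in M S -> eigenvalues M l -> S l.
Proof.
by move=> Ssym [l' Ml' Sl'] Ml; have [s ->] := eigenvalues_perm Ml' Ml; exact: Ssym.
Qed.

Lemma eigenvalues_radial (x : 'rV[R]_n) (phi psi : R -> R) (q : R)
    (u : 'rV[R]_n -> R) :
  (3 <= n)%N -> 0 < sqn x ->
  (\forall y \near x, u y = expR (- ((n%:R - 2) / 2) * phi (ln (sqn y)))) ->
  (\forall t \near ln (sqn x), is_derive (t : R) 1 phi (psi t)) ->
  is_derive (ln (sqn x)) 1 psi q ->
  let g := psi (ln (sqn x)) * (1 - psi (ln (sqn x))) in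
  exists2 k, 0 < k & eigenvalues (Amx u x) (head_tail n (k * (2 * q - g)) (k * g)).
Proof.
move=> n3 x0 ux dphi dpsi g.
exists (2 * expR (2 * phi (ln (sqn x))) / sqn x).
  by rewrite divr_gt0 // mulr_gt0 // expR_gt0.
rewrite (Amx_radial n3 x0 ux dphi dpsi).
set E := expR _; set p := psi _ in g *.
have := @eigenvalues_rank1 R n (2 * E / sqn x * (p * (1 - p)))
  (4 * E / sqn x ^+ 2 * (q - p + p ^+ 2)) x (ltn_trans (ltn0Sn 1) n3).
rewrite -/(sqn x).
have -> : 2 * E / sqn x * (p * (1 - p)) + 4 * E / sqn x ^+ 2 * (q - p + p ^+ 2) * sqn x
   = 2 * E / sqn x * (2 * q - g) by rewrite /g; field; rewrite gt_eqF.
by [].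
Qed.

End RadialEigenvalues.

(** * The annulus in the logarithmic variable *)

Section Annulus.
Context {R : realType} {n : nat} (a : R) (b : \bar R).
Hypothesis n3 : (3 <= n)%N.
Hypothesis a0 : 0 <= a.
Hypothesis ab : (a%:E < b)%E.
Implicit Types (x y : 'rV[R]_n) (t : R).

Let Om : set 'rV[R]_n := annulus a b.

Definition log_interval : set R := [set t | a < expR (t / 2) /\ ((expR (t / 2))%:E < b)%E].

Lemma enorm_continuous : continuous (@enorm R n).
Proof.
move=> x; apply: (@continuous_comp _ _ _ sqn Num.sqrt); first exact: sqn_continuous.
exact: sqrt_continuous.
Qed.

Lemma open_annulus : open Om.
Proof.
have -> : Om = @enorm R n @^-1` ([set r | a < r] `&` [set r | (r%:E < b)%E]) by [].
apply: open_comp => [x _|]; first exact: enorm_continuous.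
apply: openI; first exact: open_gt.
case: b ab => [r _|_|//].
  have -> : [set s | (s%:E < r%:E)%E] = [set s | s < r].
    by apply/seteqP; split=> s /=; rewrite lte_fin.
  exact: open_lt.
have -> : [set s : R | (s%:E < +oo)%E] = setT by apply/seteqP; split=> s //= _; exact: ltry.
exact: openT.
Qed.

Lemma log_interval_itv : is_interval log_interval.
Proof.
move=> s t [s1 s2] [t1 t2] r /andP[sr rt]; split.
  by apply: lt_le_trans s1 _; rewrite ler_expR; lra.
by apply: le_lt_trans t2; rewrite lee_fin ler_expR; lra.
Qed.

Lemma log_interval_two : exists t1 t2, [/\ log_interval t1, log_interval t2 & t1 < t2].
Proof.
have [r1 [r2 [ar1 r12 r2b]]] : exists r1 r2 : R, [/\ a < r1, r1 < r2 & (r2%:E < b)%E].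
  case: b ab => [r|_|//].
    rewrite lte_fin => ar; exists ((2 * a + r) / 3), ((a + 2 * r) / 3).
    by rewrite lte_fin; split; lra.
  by exists (a + 1), (a + 2); rewrite ltry; split => //; lra.
have e r : a < r -> expR (2 * ln r / 2) = r.
  move=> ar; rewrite (_ : 2 * ln r / 2 = ln r); last by field.
  by rewrite lnK // posrE (le_lt_trans a0).
have ar2 := lt_trans ar1 r12.
exists (2 * ln r1), (2 * ln r2); split.
- by rewrite /log_interval /= e //; split => //; apply: lt_trans r2b; rewrite lte_fin.
- by rewrite /log_interval /= e.
- by rewrite ltr_pM2l // ltr_ln // posrE (le_lt_trans a0).
Qed.

Lemma annulus_sqn_gt0 x : Om x -> 0 < sqn x.
Proof.
by move=> [ax _]; rewrite -enorm_sqn exprn_gt0 // (le_lt_trans a0).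
Qed.

Lemma annulus_enorm x : Om x -> enorm x = expR (ln (sqn x) / 2).
Proof.
move=> Ox; have s0 := annulus_sqn_gt0 Ox; rewrite /enorm -/(sqn x) -powR12_sqrt ?sqn_ge0 //.
by rewrite /powR gt_eqF // mulrC.
Qed.

Lemma annulus_log_interval x : Om x -> log_interval (ln (sqn x)).
Proof. by move=> Ox; rewrite /log_interval /= -annulus_enorm. Qed.

Let i0 : 'I_n := Ordinal (ltn_trans (ltn0Sn 1) n3).

(** A continuous section of [x |-> ln (sqn x)]: it restricts [u] to one variable and carries
    touching points back to the annulus. *)
Definition axis_point t : 'rV[R]_n := expR (t / 2) *: delta_mx 0 i0.

Lemma axis_pointE t i : axis_point t 0 i = expR (t / 2) * (i == i0)%:R.
Proof. by rewrite /axis_point !mxE. Qed.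

Lemma sqn_axis_point t : sqn (axis_point t) = expR t.
Proof.
have e : expR (t / 2) ^+ 2 = expR t.
  by rewrite expr2 -expRD; congr expR; field.
rewrite /sqn (bigD1 i0) //= big1 => [|i ii0].
  by rewrite addr0 axis_pointE eqxx mulr1.
by rewrite axis_pointE (negbTE ii0) mulr0 expr0n.
Qed.

Lemma annulus_axis_point t : log_interval t -> Om (axis_point t).
Proof.
move=> It; rewrite /Om /annulus /= /enorm -/(sqn _) sqn_axis_point.
have -> : Num.sqrt (expR t) = expR (t / 2).
  by rewrite -powR12_sqrt ?expR_ge0 // /powR gt_eqF ?expR_gt0 // expRK mulrC.
exact: It.
Qed.

Lemma axis_point_continuous : continuous axis_point.
Proof.
move=> t; apply: cvgZr_tmp.
apply: (der_continuous (der_exp (derM (der_id t) (der_cst (2^-1) t)))).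
Qed.

End Annulus.

Section Viscosity.
Context {R : realType} {n : nat} (G : set 'rV[R]_n) (a : R) (b : \bar R).
Hypothesis n3 : (3 <= n)%N.
Hypothesis Gopen : open G.
Hypothesis Gconv : convex_set (G : set (convex_lmodType 'rV[R]_n)).
Hypothesis Gsym : symmetric_set G.
Hypothesis Gcone : cone_at0 G.
Hypothesis Gpos : [set l : 'rV[R]_n | forall i : 'I_n, 0 < l 0 i] `<=` G.
Hypothesis Gtrace : G `<=` [set l : 'rV[R]_n | 0 < \sum_(i < n) l 0 i].
Hypothesis a0 : 0 <= a.
Hypothesis ab : (a%:E < b)%E.

Let n0 : (0 < n)%N := ltn_trans (ltn0Sn 1) n3.
Let Om : set 'rV[R]_n := annulus a b.
Let I := log_interval a b.
Let N2 : 0 < n%:R - 2 :> R.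
Proof. by rewrite subr_gt0 ltr_nat. Qed.

Variable u : 'rV[R]_n -> R.
Hypothesis u_radial : radial_on Om u.
Hypothesis u_visc : visc_solution G Om u.

(* [u = |x|^(-(n-2)/2) e^(-(n-2) xi / 2)] on the cylinder, with
   [h = xi + t / 2] and [t = ln |x|^2]. *)
Definition log_profile (t : R) : R := - (2 / (n%:R - 2)) * ln (u (axis_point n3 t)).

Let h := log_profile.

Lemma log_profileE x : Om x -> u x = expR (- ((n%:R - 2) / 2) * h (ln (sqn x))).
Proof.
move=> Ox; have Iln := annulus_log_interval a0 Ox.
have Oy := annulus_axis_point n3 Iln.
have -> : - ((n%:R - 2) / 2) * h (ln (sqn x)) = ln (u (axis_point n3 (ln (sqn x)))).
  by rewrite /h /log_profile; field; rewrite gt_eqF.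
have [upos _ _ _] := u_visc.
rewrite lnK; last by rewrite posrE upos.
apply: u_radial => //.
by rewrite /enorm -!/(sqn _) sqn_axis_point lnK // posrE (annulus_sqn_gt0 a0 Ox).
Qed.

Lemma log_profile_continuous t : I t -> {for t, continuous h}.
Proof.
move=> It; have Oy := annulus_axis_point n3 It.
have [upos uc _ _] := u_visc.
apply: cvgM; first exact: cvg_cst.
apply: (@continuous_comp _ _ _ (fun t => u (axis_point n3 t)) (@ln R)).
  by apply: (@continuous_comp _ _ _ (axis_point n3) u);
    [exact: axis_point_continuous|exact: uc].
by apply: continuous_ln; exact: upos.
Qed.

Let parabola (t0 p q t : R) : R := h t0 + p * (t - t0) + q * (t - t0) ^+ 2.

Let test (t0 p q : R) (x : 'rV[R]_n) : R :=
  expR (- ((n%:R - 2) / 2) * parabola t0 p q (ln (sqn x))).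

Let test_Ck k t0 p q : Ck k Om (test t0 p q).
Proof.
have Oo : open Om := open_annulus ab.
have lnC : Ck k Om (fun x => ln (sqn x)).
  by apply: Ck_ln => // [x|]; [exact: annulus_sqn_gt0|exact: Ck_sqn].
have dC : Ck k Om (fun x => ln (sqn x) - t0).
  exact: (Ck_add Oo lnC (Ck_cst Oo k (- t0))).
apply: (Ck_exp Oo); apply: (Ck_scale Oo); apply: (Ck_add Oo).
  exact: (Ck_add Oo (Ck_cst Oo k (h t0)) (Ck_scale Oo p dC)).
exact: (Ck_scale Oo q (Ck_mul Oo dC dC)).
Qed.

Let ln_axis (t : R) : ln (sqn (axis_point n3 t)) = t.
Proof. by rewrite sqn_axis_point expRK. Qed.

Let ln_sqn_continuous (t : R) : {for axis_point n3 t, continuous (fun x => ln (sqn x))}.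
Proof.
apply: (@continuous_comp _ _ _ sqn (@ln R)); first exact: sqn_continuous.
by apply: continuous_ln; rewrite sqn_axis_point expR_gt0.
Qed.

Let test_axis (t0 p q : R) : I t0 -> u (axis_point n3 t0) - test t0 p q (axis_point n3 t0) = 0.
Proof.
move=> It; rewrite (log_profileE (annulus_axis_point n3 It)) /test /parabola ln_axis.
by rewrite subrr expr0n /= !mulr0 !addr0 subrr.
Qed.

Let eigen_test (t0 p q : R) : exists2 k, 0 < k &
  eigenvalues (Amx (test t0 p q) (axis_point n3 t0))
   (head_tail n (k * (4 * q - p * (1 - p))) (k * (p * (1 - p)))).
Proof.
have xt t : is_derive (t : R) 1 (fun y => y - t0) (1 - 0).
  exact: derB (der_id t) (der_cst t0 t).
pose psi t := p + 2 * q * (t - t0).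
have dphi t : is_derive (t : R) 1 (parabola t0 p q) (psi t).
  have := derD (derD (der_cst (h t0) t) (der_scale p (xt t)))
    (der_scale q (derM (xt t) (xt t))).
  by congr is_derive; rewrite /psi; ring.
have dpsi t : is_derive (t : R) 1 psi (2 * q).
  by have := derD (der_cst p t) (der_scale (2 * q) (xt t)); congr is_derive; ring.
have s0 : 0 < sqn (axis_point n3 t0) by rewrite sqn_axis_point expR_gt0.
have nu : \forall y \near axis_point n3 t0, test t0 p q y =
    expR (- ((n%:R - 2) / 2) * parabola t0 p q (ln (sqn y))).
  by near=> y.
have nphi : \forall t \near ln (sqn (axis_point n3 t0)),
    is_derive (t : R) 1 (parabola t0 p q) (psi t).
  by near=> t; exact: dphi.
have /= := eigenvalues_radial n3 s0 nu nphi (dpsi _).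
(* The parabola has second derivative [2 * q], so the first eigenvalue is [4 * q - g] up to the
   factor [k]. *)
rewrite ln_axis /psi subrr mulr0 addr0 mulrA -natrM.
by apply.
Unshelve. all: by end_near. Qed.

(** The negative factor in the exponent reverses the order: a parabola above [h] lifts to a test
    function below [u], the case governed by [closure G]. *)
Lemma touched_above_closure t0 p q : I t0 -> touched_above h t0 p q ->
  closure G (head_tail n (4 * q - p * (1 - p)) (p * (1 - p))).
Proof.
move=> It touch; have Ox := annulus_axis_point n3 It.
have [_ _ [_ _ sup] _] := u_visc.
have [k k0 ek] := eigen_test t0 p q.
apply/(head_tail_closure Gconv Gcone Gpos _ _ k0).
apply: (lambda_in_symmetric (closure_symmetric Gconv Gsym Gcone Gpos) _ ek).
apply: (sup _ _ Ox (@test_Ck 2 t0 p q) (test_axis p q It)).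
have nO : \forall x \near axis_point n3 t0, Om x.
  by apply: open_nbhs_nbhs; split => //; exact: open_annulus.
have nt : \forall x \near axis_point n3 t0, h (ln (sqn x)) <= parabola t0 p q (ln (sqn x)).
  by have := @ln_sqn_continuous t0; rewrite /prop_for /continuous_at ln_axis => /(_ _ touch).
apply: filterS2 nO nt => x Ox' le.
by rewrite (log_profileE Ox') subr_ge0 ler_expR ler_nM2l // oppr_lt0 divr_gt0.
Qed.

Lemma touched_below_compl t0 p q : I t0 -> touched_below h t0 p q ->
  ~ G (head_tail n (4 * q - p * (1 - p)) (p * (1 - p))).
Proof.
move=> It touch; have Ox := annulus_axis_point n3 It.
have [_ _ _ [_ _ sub]] := u_visc.
have [k k0 ek] := eigen_test t0 p q.
move=> /(head_tail_cone Gcone _ _ k0).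
apply: (lambda_in_symmetric (compl_symmetric Gsym) _ ek).
apply: (sub _ _ Ox (@test_Ck 2 t0 p q) (test_axis p q It)).
have nO : \forall x \near axis_point n3 t0, Om x.
  by apply: open_nbhs_nbhs; split => //; exact: open_annulus.
have nt : \forall x \near axis_point n3 t0, parabola t0 p q (ln (sqn x)) <= h (ln (sqn x)).
  by have := @ln_sqn_continuous t0; rewrite /prop_for /continuous_at ln_axis => /(_ _ touch).
apply: filterS2 nO nt => x Ox' le.
by rewrite (log_profileE Ox') subr_le0 ler_expR ler_nM2l // oppr_lt0 divr_gt0.
Qed.

Lemma log_profile_classification :
  let nup := (mu_plus G - 1) / 2 in
  let num := (fine (mu_minus G) - 1) / 2 in
  exists2 t1, I t1 & exists sigma,
   [\/ [/\ 0 <= sigma, 0 <= expR (nup * t1) - expR (nup * h t1) * sigma &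
           collinear_from I h nup t1 sigma],
       [/\ (mu_minus G < +oo)%E, 0 < sigma,
           expR (num * t1) - expR (num * h t1) * sigma < 0 &
           collinear_from I h num t1 sigma] |
       [/\ (mu_minus G < +oo)%E, sigma < 0,
           0 < expR (num * t1) - expR (num * h t1) * sigma &
           collinear_from I h num t1 sigma]].
Proof.
move=> nup num.
have pos (x : R) : Num.sg x = 1 -> 0 < x by move=> e; rewrite -sgr_gt0 e.
have neg (x : R) : Num.sg x = -1 -> x < 0 by move=> e; rewrite -sgr_lt0 e ltrN10.
have [_ plus] := mu_plus_spec n0 Gopen Gconv Gcone Gpos Gtrace.
apply: (classification (@log_interval_itv _ a b) log_profile_continuous
  (log_interval_two a0 ab)).
- move=> t p q It /pos p0 /pos p1 /(touched_above_closure It).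
  have g0 := mulr_gt0 p0 p1.
  by move=> /(plus _ _ g0).2; rewrite /nup; lra.
- move=> t p q It /pos p0 /pos p1 /(touched_below_compl It) nG.
  have g0 := mulr_gt0 p0 p1.
  have : 4 * q - p * (1 - p) <= - mu_plus G * (p * (1 - p)).
    by rewrite leNgt; apply/negP => /(plus _ _ g0).1.
  by rewrite /nup; lra.
have [[-> minus]|[m [mE _ minus]]] := mu_minus_spec n0 Gopen Gconv Gcone Gpos Gtrace.
  (* With [g < 0] the eigenvalues cannot lie in the closure, so the supersolution conditions hold
     vacuously for every [nu]. *)
  right=> nu; split=> t p q It; [move=> /pos p0 /neg p1|move=> /neg p0 /pos p1];
    move=> /(touched_above_closure It) /minus; case.
    by rewrite pmulr_rlt0.
  by rewrite nmulr_rlt0.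
left; rewrite /num mE /= ltry; split=> //.
have above s1 s2 : s1 * s2 = -1 -> supersol_in I s1 s2 ((m - 1) / 2) h.
  move=> s12 t p q It sp sp' /(touched_above_closure It).
  have g0 : p * (1 - p) < 0 by apply: neg; rewrite sgrM sp sp'.
  by move=> /(minus _ _ g0).2; lra.
have below s1 s2 : s1 * s2 = -1 -> subsol_in I s1 s2 ((m - 1) / 2) h.
  move=> s12 t p q It sp sp' /(touched_below_compl It) nG.
  have g0 : p * (1 - p) < 0 by apply: neg; rewrite sgrM sp sp'.
  have : 4 * q - p * (1 - p) <= - m * (p * (1 - p)).
    by rewrite leNgt; apply/negP => /(minus _ _ g0).1.
  by lra.
by split; (apply: above || apply: below); rewrite ?mul1r ?mulr1.
Qed.

End Viscosity.

(** * The explicit families *)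

Section ExplicitSolutions.
Context {R : realType} {n : nat} (G : set 'rV[R]_n) (a : R) (b : \bar R).
Hypothesis n3 : (3 <= n)%N.
Hypothesis Gopen : open G.
Hypothesis Gconv : convex_set (G : set (convex_lmodType 'rV[R]_n)).
Hypothesis Gcone : cone_at0 G.
Hypothesis Gpos : [set l : 'rV[R]_n | forall i : 'I_n, 0 < l 0 i] `<=` G.
Hypothesis Gtrace : G `<=` [set l : 'rV[R]_n | 0 < \sum_(i < n) l 0 i].
Hypothesis a0 : 0 <= a.
Hypothesis ab : (a%:E < b)%E.

Let n0 : (0 < n)%N := ltn_trans (ltn0Sn 1) n3.
Let Om : set 'rV[R]_n := annulus a b.
Let I := log_interval a b.

Lemma frontier_scale k s t : 0 < k -> frontier G (head_tail n s t) ->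
  frontier G (head_tail n (k * s) (k * t)).
Proof.
move=> k0 /(frontier_coneE Gopen)[cl nG]; apply/(frontier_coneE Gopen); split.
  exact: (head_tail_closure Gconv Gcone Gpos s t k0).2.
by move=> /(head_tail_cone Gcone s t k0).
Qed.

(** Covers the members of the families with [g = 0], such as positive constants, for which all
    eigenvalues vanish. *)
Lemma frontier_head_tail0 : frontier G (head_tail n 0 0).
Proof.
apply/(frontier_coneE Gopen); split.
  apply/(closure_coneE Gconv Gcone Gpos) => e e0; apply: Gpos => i /=.
  by rewrite !mxE if_same add0r.
by move=> /Gtrace /=; rewrite (sum_head_tail n0) mulr0 addr0 ltxx.
Qed.

Lemma log_interval_near t : I t -> \forall s \near t, I s.
Proof.
move=> It; have Oy : Om (axis_point n3 t) := annulus_axis_point n3 It.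
have nOm : \forall s \near t, Om (axis_point n3 s).
  have := open_nbhs_nbhs (conj (open_annulus (n := n) ab) Oy).
  by move=> /(@axis_point_continuous R n n3 t _).
apply: filterS nOm => s Os.
have := annulus_log_interval a0 Os.
by rewrite sqn_axis_point expRK.
Qed.

Lemma smooth_solution_radial (u : 'rV[R]_n -> R) (phi psi q : R -> R) :
  (forall x, Om x -> u x = expR (- ((n%:R - 2) / 2) * phi (ln (sqn x)))) ->
  smooth_on Om u ->
  (forall t, I t -> is_derive t 1 phi (psi t)) ->
  (forall t, I t -> is_derive t 1 psi (q t)) ->
  (forall t, I t -> frontier G (head_tail n (2 * q t - psi t * (1 - psi t))
     (psi t * (1 - psi t)))) ->
  smooth_solution G Om u.
Proof.
move=> uE us dphi dpsi fr; split=> // x Ox; first by rewrite uE // expR_gt0.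
have It := annulus_log_interval a0 Ox.
have nu : \forall y \near x, u y = expR (- ((n%:R - 2) / 2) * phi (ln (sqn y))).
  by apply: filterS (open_nbhs_nbhs (conj (open_annulus ab) Ox)); exact: uE.
have nphi : \forall t \near ln (sqn x), is_derive (t : R) 1 phi (psi t).
  by apply: filterS (log_interval_near It); exact: dphi.
have /= [k k0 ek] := eigenvalues_radial n3 (annulus_sqn_gt0 a0 Ox) nu nphi (dpsi _ It).
by exists (head_tail n (k * (2 * q (ln (sqn x)) - psi (ln (sqn x)) * (1 - psi (ln (sqn x)))))
  (k * (psi (ln (sqn x)) * (1 - psi (ln (sqn x)))))); last exact: frontier_scale (fr _ It).
Qed.

Let Oo : open Om := open_annulus ab.

Let lnC k : Ck k Om (fun x => ln (sqn x)).
Proof. by apply: (Ck_ln Oo) => [x|]; [exact: annulus_sqn_gt0|exact: Ck_sqn]. Qed.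

Lemma annulus_powR x r : Om x -> enorm x `^ r = expR (r / 2 * ln (sqn x)).
Proof.
move=> Ox; rewrite (annulus_enorm a0 Ox) /powR gt_eqF ?expR_gt0 // expRK.
by congr expR; field.
Qed.

(** One computation for (b), (c) and (d): [psi] is [A * E / base] and [1 - psi] is [B / base], so
    [g] has the constant sign of [A * B], and only that sign has to be tested against the cone. *)
Lemma power_solution (mu A B : R) (u : 'rV[R]_n -> R) : mu != 1 ->
  (forall x, Om x -> 0 < A * enorm x `^ (- mu + 1) + B) ->
  (forall x, Om x ->
     u x = (A * enorm x `^ (- mu + 1) + B) `^ ((n%:R - 2) / (mu - 1))) ->
  (forall g, Num.sg g = Num.sg (A * B) -> frontier G (head_tail n (- mu * g) g)) ->
  smooth_solution G Om u.
Proof.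
move=> mu1 bpos uE fr.
pose nu := (mu - 1) / 2.
have mu0 : mu - 1 != 0 by rewrite subr_eq0.
have nu0 : nu != 0 by rewrite mulf_neq0 // invr_neq0 // pnatr_eq0.
pose E (t : R) := expR (- nu * t).
pose base t := A * E t + B.
have baseE x : Om x -> A * enorm x `^ (- mu + 1) + B = base (ln (sqn x)).
  move=> Ox; rewrite (annulus_powR _ Ox) /base /E.
  by rewrite (_ : (- mu + 1) / 2 = - nu) // /nu; field.
have base0 t : I t -> 0 < base t.
  move=> It; have Oy := annulus_axis_point n3 It.
  by have := bpos _ Oy; rewrite baseE // sqn_axis_point expRK.
pose phi t := - nu^-1 * ln (base t).
pose psi t := A * E t / base t.
pose q t := - nu * (psi t * (1 - psi t)).
have psi1 t : I t -> 1 - psi t = B / base t.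
  move=> It; rewrite /psi -{1}(divff (lt0r_neq0 (base0 t It))) -mulrBl.
  by rewrite /base addrAC subrr add0r.
have dE (t : R) : is_derive t 1 E (- nu * E t).
  by have := der_exp (der_scale (- nu) (der_id t)); congr is_derive; rewrite /E; ring.
have dbase (t : R) : is_derive t 1 base (- nu * (A * E t)).
  by have := derD (der_scale A (dE t)) (der_cst B t); congr is_derive; ring.
apply: (smooth_solution_radial (phi := phi) (psi := psi) (q := q)).
- move=> x Ox; rewrite uE // baseE //; have It := annulus_log_interval a0 Ox.
  rewrite /powR gt_eqF ?base0 //; congr expR; rewrite /phi /nu.
  by field; rewrite mu0.
- move=> k; have Ebase : Ck k Om (fun x => base (ln (sqn x))).
    apply: (Ck_add Oo); last exact: (Ck_cst Oo).
    by apply: (Ck_scale Oo); apply: (Ck_exp Oo); exact: (Ck_scale Oo).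
  have := Ck_exp Oo (Ck_scale Oo ((n%:R - 2) / (mu - 1)) (Ck_ln Oo _ Ebase)).
  move=> /(_ (fun x Ox => base0 _ (annulus_log_interval a0 Ox))).
  apply: (Ck_ext Oo) => x Ox; rewrite uE // baseE //.
  by rewrite /powR gt_eqF ?base0 //; exact: annulus_log_interval.
- move=> t It; have := der_scale (- nu^-1) (der_ln (base0 t It) (dbase t)).
  congr is_derive; rewrite /psi; field.
  by rewrite nu0 gt_eqF ?base0.
- move=> t It; have b0 := lt0r_neq0 (base0 t It).
  have := derM (der_scale A (dE t)) (derV b0 (dbase t)).
  congr is_derive; rewrite /q psi1 // /psi; move: b0; rewrite /base => b0.
  by field.
- move=> t It.
  have -> : 2 * q t - psi t * (1 - psi t) = - mu * (psi t * (1 - psi t)).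
    by rewrite /q /nu; field.
  apply: fr; rewrite psi1 // /psi !sgrM !sgrV (gtr0_sg (base0 t It)) !mulr1.
  by rewrite (gtr0_sg (expR_gt0 _)) mulr1.
Qed.

Lemma log_linear_solution (c0 c1 : R) (u : 'rV[R]_n -> R) : 0 < c0 ->
  (forall x, Om x -> u x = c0 * enorm x `^ (- c1)) ->
  (forall g, Num.sg g = Num.sg (c1 * (n%:R - 2 - c1)) ->
     frontier G (head_tail n (- g) g)) ->
  smooth_solution G Om u.
Proof.
move=> c00 uE fr.
have N2 : 0 < n%:R - 2 :> R by rewrite subr_gt0 ltr_nat.
pose al := - (2 / (n%:R - 2)) * ln c0; pose p := c1 / (n%:R - 2).
have uE' x : Om x -> u x = expR (- ((n%:R - 2) / 2) * (al + p * ln (sqn x))).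
  move=> Ox; rewrite uE // annulus_powR // -{1}[c0]lnK // -expRD.
  by congr expR; rewrite /al /p; field; rewrite gt_eqF.
apply: (smooth_solution_radial (phi := fun t => al + p * t) (psi := fun=> p)
  (q := fun=> 0)) => //.
- move=> k; have := Ck_exp Oo (Ck_scale Oo (- ((n%:R - 2) / 2))
    (Ck_add Oo (Ck_cst Oo k al) (Ck_scale Oo p (lnC k)))).
  by apply: (Ck_ext Oo) => x Ox; rewrite uE'.
- move=> t _; have := derD (der_cst al t) (der_scale p (der_id t)).
  by rewrite add0r mulr1.
- move=> t _; rewrite mulr0 sub0r; apply: fr.
  have -> : c1 * (n%:R - 2 - c1) = (n%:R - 2) ^+ 2 * (p * (1 - p)).
    by rewrite /p; field; rewrite gt_eqF.
  by rewrite [in RHS]sgrM [X in _ = X * _]gtr0_sg ?mul1r // exprn_gt0.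
Qed.

End ExplicitSolutions.

(** * Behaviour of the families at the ends of the annulus *)

Section Ends.
Context {R : realType}.

Instance to_upper_end_filter (b : \bar R) : ProperFilter (to_upper_end b).
Proof. by case: b => [r||] /=; exact: _. Qed.

Lemma to_upper_end_near (b : \bar R) (r0 : R) : (r0%:E < b)%E ->
  \forall r \near to_upper_end b, r0 < r /\ (r%:E < b)%E.
Proof.
case: b => [b|_|//] /=.
  rewrite lte_fin => r0b; near=> r.
  by split; [near: r; exact: nbhs_left_gt|rewrite lte_fin].
near=> r; split; last exact: ltry.
by near: r; exact: nbhs_pinfty_gt (num_real _).
Unshelve. all: by end_near. Qed.

Lemma powR_decr (c r s : R) : c < 0 -> 0 < r -> r < s -> s `^ c < r `^ c.
Proof.
move=> c0 r0 rs; have s0 := lt_trans r0 rs.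
by rewrite /powR !gt_eqF // ltr_expR ltr_nM2l // ltr_ln // posrE.
Qed.

Lemma powR_continuous (c r : R) : 0 < r -> {for r, continuous (fun x => x `^ c)}.
Proof.
move=> r0; have d := der_continuous (der_exp (der_scale c (is_derive1_ln r0))).
rewrite /prop_for /continuous_at {2}/powR gt_eqF //.
have e : \forall x \near r, expR (c * ln x) = x `^ c.
  have nr : \forall x \near r, 0 < x.
    exact: (cvgr_gt _ (der_continuous (der_id r))).
  by apply: filterS nr => x x0; rewrite /powR gt_eqF.
exact: cvg_trans (near_eq_cvg e) d.
Qed.

Lemma powR_cvgy0 (c : R) : c < 0 -> r `^ c @[r --> +oo] --> (0 : R).
Proof.
move=> c0; apply/cvgrPdist_le => e e0.
near=> r.
have r1 : expR (ln e / c) < r by near: r; exact: nbhs_pinfty_gt (num_real _).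
have r0 : 0 < r := lt_trans (expR_gt0 _) r1.
rewrite sub0r normrN ger0_norm ?powR_ge0 // /powR gt_eqF // -[leRHS]lnK // ler_expR.
rewrite -[leRHS](divfK (ltr0_neq0 c0)) [leRHS]mulrC ler_nM2l //.
by rewrite -ler_expR lnK // ltW.
Unshelve. all: by end_near. Qed.

Lemma cvg_EFin_ge0 (F : set_system R) (f : R -> R) (l : R) : ProperFilter F ->
  f @ F --> l -> (\forall r \near F, 0 < f r) ->
  exists2 l' : \bar R, (f r)%:E @[r --> F] --> l' & (0 <= l')%E.
Proof.
move=> PF fl f0; exists l%:E.
  apply: cvg_EFin; last exact: fl.
  by apply: filterS f0 => r _.
by rewrite lee_fin; apply: (cvgr_to_ge fl); apply: filterS f0 => r /ltW.
Qed.

(** The base decreases strictly in [r], so its value at [r] exceeds a later value, which is at least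
    the limit. *)
Lemma power_pos_below (mu C5 C6 : R) (b l : \bar R) : 1 < mu -> 0 < C5 ->
  (C5 * r `^ (- mu + 1) - C6)%:E @[r --> to_upper_end b] --> l -> (0 <= l)%E ->
  forall r, 0 < r -> (r%:E < b)%E -> 0 < C5 * r `^ (- mu + 1) - C6.
Proof.
move=> mu1 C50 fl l0 r r0 rb.
have c0 : - mu + 1 < 0 by lra.
have [s [rs sb]] : exists s, r < s /\ (s%:E < b)%E.
  by have [s] := filter_ex (to_upper_end_near rb); exists s.
have ls : (l <= (C5 * s `^ (- mu + 1) - C6)%:E)%E.
  apply: (cvge_to_le fl); apply: filterS (to_upper_end_near sb) => t [st _].
  rewrite lee_fin lerD2r ler_pM2l // ltW // powR_decr //; exact: lt_trans rs.
have : 0 <= C5 * s `^ (- mu + 1) - C6 by rewrite -lee_fin (le_trans l0).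
have : C5 * s `^ (- mu + 1) < C5 * r `^ (- mu + 1) by rewrite ltr_pM2l // powR_decr.
lra.
Qed.

Lemma power_pos_above (mu C7 C8 a : R) (l : \bar R) : 1 < mu -> 0 <= C7 -> 0 < C8 ->
  0 <= a -> (- C7 * r `^ (- mu + 1) + C8)%:E @[r --> a^'+] --> l -> (0 <= l)%E ->
  forall r, a < r -> 0 < - C7 * r `^ (- mu + 1) + C8.
Proof.
move=> mu1; rewrite le_eqVlt => /orP[/eqP<- C80 _ _ _ r _|C70 C80 a0 fl l0 r ar].
  by rewrite oppr0 mul0r add0r.
have c0 : - mu + 1 < 0 by lra.
pose s := (a + r) / 2; have as_ : a < s by rewrite /s; lra.
have sr : s < r by rewrite /s; lra.
have ls : (l <= (- C7 * s `^ (- mu + 1) + C8)%:E)%E.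
  apply: (cvge_to_le fl); near=> t.
  have at_ : a < t by [].
  have ts : t < s by near: t; exact: nbhs_right_lt.
  rewrite lee_fin lerD2r !mulNr lerN2 ler_pM2l // ltW // powR_decr //.
  exact: le_lt_trans at_.
have : 0 <= - C7 * s `^ (- mu + 1) + C8 by rewrite -lee_fin (le_trans l0).
have : C7 * r `^ (- mu + 1) < C7 * s `^ (- mu + 1).
  by rewrite ltr_pM2l // powR_decr // (le_lt_trans a0).
lra.
Unshelve. all: by end_near. Qed.

End Ends.

Section Forms.
Context {R : realType} {n : nat} (G : set 'rV[R]_n) (a : R) (b : \bar R).
Hypothesis n3 : (3 <= n)%N.
Hypothesis Gopen : open G.
Hypothesis Gconv : convex_set (G : set (convex_lmodType 'rV[R]_n)).
Hypothesis Gsym : symmetric_set G.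
Hypothesis Gcone : cone_at0 G.
Hypothesis Gpos : [set l : 'rV[R]_n | forall i : 'I_n, 0 < l 0 i] `<=` G.
Hypothesis Gtrace : G `<=` [set l : 'rV[R]_n | 0 < \sum_(i < n) l 0 i].
Hypothesis a0 : 0 <= a.
Hypothesis ab : (a%:E < b)%E.

Let n0 : (0 < n)%N := ltn_trans (ltn0Sn 1) n3.
Let Om : set 'rV[R]_n := annulus a b.
Let I := log_interval a b.
Let N2 : 0 < n%:R - 2 :> R.
Proof. by rewrite subr_gt0 ltr_nat. Qed.

Let enorm_gt0 x : Om x -> 0 < enorm x.
Proof. by move=> [ax _]; exact: le_lt_trans ax. Qed.

Lemma enorm_surj r : a < r -> (r%:E < b)%E -> exists2 x, Om x & enorm x = r.
Proof.
move=> ar rb; have r0 : 0 < r := le_lt_trans a0 ar.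
have e : expR (2 * ln r / 2) = r.
  by rewrite (_ : 2 * ln r / 2 = ln r) ?lnK //; field.
have It : I (2 * ln r) by rewrite /I /log_interval /= e.
have Ox := annulus_axis_point n3 It.
exists (axis_point n3 (2 * ln r)) => //.
by rewrite (annulus_enorm a0 Ox) sqn_axis_point expRK.
Qed.

Lemma at_right_near : \forall r \near a^'+, a < r /\ (r%:E < b)%E.
Proof.
near=> r; split=> //; near: r.
case: b ab => [b'|_|//]; last by near=> r; exact: ltry.
rewrite lte_fin => ab'; near=> r; rewrite lte_fin; near: r.
exact: nbhs_right_lt.
Unshelve. all: by end_near. Qed.

(** Collinearity expresses [expR (- nu * h)] as the base of the power, which is therefore positive.
    Up to a positive factor [B] is the second quantity whose sign [classification] controls, so the
    regime fixes the signs of both constants. *)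
Lemma collinear_power (mu t1 sigma : R) (h : R -> R) (u : 'rV[R]_n -> R) :
  let nu := (mu - 1) / 2 in
  mu != 1 -> (forall x, Om x -> u x = expR (- ((n%:R - 2) / 2) * h (ln (sqn x)))) ->
  collinear_from I h nu t1 sigma ->
  exists2 B, Num.sg B = Num.sg (expR (nu * t1) - expR (nu * h t1) * sigma) &
  forall x, Om x -> 0 < sigma * enorm x `^ (- mu + 1) + B /\
    u x = (sigma * enorm x `^ (- mu + 1) + B) `^ ((n%:R - 2) / (mu - 1)).
Proof.
move=> nu mu1 uE col.
have mu0 : mu - 1 != 0 by rewrite subr_eq0.
pose B := expR (- nu * h t1) - sigma * expR (- nu * t1).
have eB : B = expR (- nu * (h t1 + t1)) * (expR (nu * t1) - expR (nu * h t1) * sigma).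
  rewrite mulrBr mulrA -!expRD /B [sigma * _]mulrC.
  by congr (expR _ - expR _ * _); ring.
exists B; first by rewrite eB sgrM (gtr0_sg (expR_gt0 _)) mul1r.
move=> x Ox; have It := annulus_log_interval a0 Ox.
have -> : sigma * enorm x `^ (- mu + 1) + B = expR (- nu * h (ln (sqn x))).
  rewrite (annulus_powR a0 _ Ox) (_ : (- mu + 1) / 2 = - nu); last by rewrite /nu; field.
  by rewrite /B !expR_lincoord; have /(congr1 ( *%R nu)) := col _ It; lra.
split; first exact: expR_gt0.
rewrite uE // /powR gt_eqF ?expR_gt0 // expRK; congr expR.
by rewrite /nu; field.
Qed.

Lemma radial_visc_solution_form u : radial_on Om u -> visc_solution G Om u ->
  [\/ form_a G a b u, form_b G a b u, form_c G a b u | form_d G a b u].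
Proof.
move=> urad uvisc.
have uE := log_profileE n3 a0 urad uvisc.
have [t1 It1] := log_profile_classification n3 Gopen Gconv Gsym Gcone Gpos Gtrace a0 ab urad uvisc.
set h := log_profile n3 u in uE *.
have Ox1 : Om (axis_point n3 t1) := annulus_axis_point n3 It1.
have mum := mu_minus_spec n0 Gopen Gconv Gcone Gpos Gtrace.
(* Since [mu_minus >= n - 1 >= 2], the exponent of (c) and (d) never degenerates as it does for
   [mu_plus = 1]. *)
have finite_mu : (mu_minus G < +oo)%E -> 1 < fine (mu_minus G).
  case: mum => [[-> _]//|[m [-> m1 _ _]]]; rewrite /=.
  have : (3 : R) <= n%:R by rewrite ler_nat.
  by lra.
move=> [sigma [[s0 s1 col]|[mfin s0 s1 col]|[mfin s0 s1 col]]].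
- have [mu1|mu1] := eqVneq (mu_plus G) 1.
    constructor 1; split=> //.
    (* Here [nu = 0] and the coordinate is the identity: [h] is affine of slope [sigma] in [0, 1],
       so [u] is a pure power with [C2 = (n - 2) * sigma]. *)
    move: s1 col; rewrite mu1 subrr !mul0r expR0 mul1r subr_ge0 => s1 col.
    exists (expR (- ((n%:R - 2) / 2) * (h t1 - sigma * t1))), ((n%:R - 2) * sigma).
    split; [exact: expR_gt0| |].
      by rewrite mulr_ge0 //= ?(ltW N2) // -[leRHS]mulr1 ler_pM2l.
    move=> x Ox; have It := annulus_log_interval a0 Ox.
    rewrite uE // (annulus_powR a0 _ Ox) -expRD; congr expR.
    have := col _ It; rewrite /lincoord eqxx => e.
    have -> : h (ln (sqn x)) = h t1 + sigma * (ln (sqn x) - t1) by lra.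
    by field.
  have [B sgB uB] := collinear_power mu1 uE col.
  have B0 : 0 <= B by rewrite -sgr_ge0 sgB sgr_ge0.
  constructor 2; split=> //; exists sigma, B; split => //; last by move=> x /uB[].
  (* Both constants cannot vanish, because the base is positive at a point of the annulus. *)
  rewrite lt_neqAle addr_ge0 // andbT eq_sym paddr_eq0 //.
  apply/negP => /andP[/eqP z1 /eqP z2].
  by have [+ _] := uB _ Ox1; rewrite z1 z2 mul0r addr0 ltxx.
- have mu1 := finite_mu mfin; have mu1' : fine (mu_minus G) != 1 by rewrite gt_eqF.
  have [B sgB uB] := collinear_power mu1' uE col.
  have B0 : B < 0 by rewrite -sgr_lt0 sgB sgr_lt0.
  constructor 3; split=> //; exists sigma, (- B); split => //.
  + by lra.
  + pose f r := sigma * r `^ (- fine (mu_minus G) + 1) - (- B).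
    have fpos : \forall r \near to_upper_end b, 0 < f r.
      apply: (filterS (F := to_upper_end b) _ (to_upper_end_near ab)).
        exact: (to_upper_end_filter b).
      move=> r [ar rb]; have [x Ox <-] := enorm_surj ar rb.
      by rewrite /f opprK; have [] := uB _ Ox.
    have [L fL] : exists L : R, f r @[r --> to_upper_end b] --> L.
      have fc r : 0 < r -> {for r, continuous f}.
        move=> r0; apply: cvgB; last exact: cvg_cst.
        by apply: cvgM; [exact: cvg_cst|exact: powR_continuous].
      move: ab; rewrite /f; case: b => [b'|_|//] /=.
        rewrite lte_fin => ab'; exists (f b'); apply: cvg_at_left_filter.
        exact: fc (le_lt_trans a0 ab').
      exists (sigma * 0 - (- B)); apply: cvgB; last exact: cvg_cst.
      by apply: cvgM; [exact: cvg_cst|apply: powR_cvgy0; lra].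
    exact: cvg_EFin_ge0 (to_upper_end_filter b) fL fpos.
  + by move=> x /uB[_ ->]; rewrite opprK.
- have mu1 := finite_mu mfin; have mu1' : fine (mu_minus G) != 1 by rewrite gt_eqF.
  have [B sgB uB] := collinear_power mu1' uE col.
  have B0 : 0 < B by rewrite -sgr_gt0 sgB sgr_gt0.
  constructor 4; split=> //; exists (- sigma), B; split => //.
  + by lra.
  + pose f r := - - sigma * r `^ (- fine (mu_minus G) + 1) + B.
    have fpos : \forall r \near a^'+, 0 < f r.
      apply: filterS at_right_near => r [ar rb].
      have [x Ox <-] := enorm_surj ar rb.
      by rewrite /f opprK; have [] := uB _ Ox.
    have [L fL] : exists L : R, f r @[r --> a^'+] --> L.
      move: a0; rewrite le_eqVlt => /orP[/eqP a00|a00].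
        (* For [a = 0] this regime cannot occur: multiplied by [r ^ (mu - 1)], the positive base
           becomes [sigma + B * r ^ (mu - 1)], which is negative once [r ^ (mu - 1) < e]. *)
        exfalso; pose e := - sigma / B.
        have e0 : 0 < e by rewrite divr_gt0 // oppr_gt0.
        have mu0 : 0 < fine (mu_minus G) - 1 by lra.
        have small : \forall r \near (0 : R)^'+, r `^ (fine (mu_minus G) - 1) < e.
          exact: (cvgr_lt _ (powR_cvg0 mu0)).
        rewrite -a00 in fpos.
        have all3 : \forall r \near (0 : R)^'+, 0 < f r /\
            (r `^ (fine (mu_minus G) - 1) < e /\ 0 < r).
          exact: filterI fpos (filterI small (nbhs_right_gt (0 : R))).
        have [r [rpos [rsmall r0]]] := @filter_ex _ _ (at_right_proper_filter (0 : R)) _ all3.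
        have k0 : 0 < r `^ (fine (mu_minus G) - 1) by rewrite powR_gt0.
        move: rpos rsmall; rewrite /f opprK (_ : - fine (mu_minus G) + 1 =
          - (fine (mu_minus G) - 1)); last by ring.
        rewrite powRN /e; move: k0; move: (r `^ _) => k k0 kpos.
        have := mulr_gt0 kpos k0; rewrite mulrDl -mulrA mulVf ?gt_eqF // ltr_pdivlMr //.
        lra.
      exists (f a); apply: cvg_at_right_filter; apply: cvgD; last exact: cvg_cst.
      by apply: cvgM; [exact: cvg_cst|exact: powR_continuous].
    exact: cvg_EFin_ge0 fL fpos.
  + by move=> x /uB[_ ->]; rewrite opprK.
Qed.

Lemma form_solution u :
  [\/ form_a G a b u, form_b G a b u, form_c G a b u | form_d G a b u] ->
  smooth_solution G Om u.
Proof.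
have [mup plus] := mu_plus_spec n0 Gopen Gconv Gcone Gpos Gtrace.
have fr0 := frontier_head_tail0 n3 Gopen Gconv Gcone Gpos Gtrace.
have fr_plus g : 0 <= g -> frontier G (head_tail n (- mu_plus G * g) g).
  rewrite le_eqVlt => /orP[/eqP <-|g0]; first by rewrite mulr0.
  apply/(frontier_coneE Gopen); split; first exact: ((plus _ _ g0).2).2.
  by move=> /(plus _ _ g0).1; rewrite ltxx.
have fr_minus : (mu_minus G < +oo)%E -> 1 < fine (mu_minus G) /\
    forall g, g <= 0 -> frontier G (head_tail n (- fine (mu_minus G) * g) g).
  case: (mu_minus_spec n0 Gopen Gconv Gcone Gpos Gtrace) => [[-> _]//|[m [-> m1 minus]]] _.
  have n3' : (3 : R) <= n%:R by rewrite ler_nat.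
  split=> [/=|g]; first by lra.
  rewrite le_eqVlt => /orP[/eqP ->|g0]; first by rewrite mulr0.
  apply/(frontier_coneE Gopen); split; first exact: ((minus _ _ g0).2).2.
  by move=> /(minus _ _ g0).1; rewrite ltxx.
case=> [[mu1 [C1 [C2 [C10 C20 uE]]]]|[mu1 [C3 [C4 [C30 C40 C340 uE]]]]|
  [mfin [C5 [C6 [C50 C60 [l fl l0] uE]]]]|[mfin [C7 [C8 [C70 C80 [l fl l0] uE]]]]].
- apply: (log_linear_solution n3 Gopen Gconv Gcone Gpos a0 ab C10 uE) => g sg.
  rewrite -[- g]mulN1r -mu1; apply: fr_plus; rewrite -sgr_ge0 sg sgr_ge0.
  by case/andP: C20 => c1 c2; rewrite mulr_ge0 // subr_ge0.
- apply: (power_solution n3 Gopen Gconv Gcone Gpos a0 ab mu1 _ uE) => [x Ox|g sg].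
    have p0 : 0 < enorm x `^ (- mu_plus G + 1) by rewrite powR_gt0 // enorm_gt0.
    move: C30; rewrite le_eqVlt => /orP[/eqP C3z|C30'].
      by move: C340; rewrite -C3z !add0r mul0r add0r.
    by rewrite ltr_wpDr // mulr_gt0.
  by apply: fr_plus; rewrite -sgr_ge0 sg sgr_ge0 mulr_ge0.
- have [mu1 fr] := fr_minus mfin.
  apply: (power_solution n3 Gopen Gconv Gcone Gpos a0 ab _ _ uE) => [|x Ox|g sg].
  + by rewrite gt_eqF.
  + by apply: (power_pos_below mu1 C50 fl l0); [exact: enorm_gt0|case: Ox].
  + by apply: fr; rewrite -sgr_le0 sg sgr_le0 mulrN oppr_le0 mulr_ge0 // ltW.
- have [mu1 fr] := fr_minus mfin.
  apply: (power_solution n3 Gopen Gconv Gcone Gpos a0 ab _ _ uE) => [|x Ox|g sg].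
  + by rewrite gt_eqF.
  + by apply: (power_pos_above mu1 C70 C80 a0 fl l0); case: Ox.
  + by apply: fr; rewrite -sgr_le0 sg sgr_le0 mulNr oppr_le0 mulr_ge0 // ltW.
Qed.

End Forms.

Unset Implicit Arguments.

(** The second conjunct renders the words smooth solutions: each listed function solves the equation
    classically, with the side conditions on the limits ensuring positivity. *)
Theorem theorem2p2 (R : realType) (n : nat) (G : set 'rV[R]_n)
    (a : R) (b : \bar R) :
  (3 <= n)%N ->
  open G ->
  convex_set (G : set (convex_lmodType 'rV[R]_n)) ->
  symmetric_set G ->
  cone_at0 G ->
  [set l : 'rV[R]_n | forall i : 'I_n, 0 < l 0 i] `<=` G ->
  G `<=` [set l : 'rV[R]_n | 0 < \sum_(i < n) l 0 i] ->
  0 <= a ->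
  (a%:E < b)%E ->
  (forall u : 'rV[R]_n -> R,
     radial_on (annulus a b) u ->
     visc_solution G (annulus a b) u ->
     [\/ form_a G a b u, form_b G a b u, form_c G a b u | form_d G a b u]) /\
  (forall u : 'rV[R]_n -> R,
     [\/ form_a G a b u, form_b G a b u, form_c G a b u | form_d G a b u] ->
     smooth_solution G (annulus a b) u).
Proof.
move=> n3 Gopen Gconv Gsym Gcone Gpos Gtrace a0 ab; split=> u.
  exact: radial_visc_solution_form.
exact: form_solution.
Qed.
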